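(* Let $\alpha\in[0,\tfrac12]$, and let $(K_{i,j})_{i,j\ge1}$ and $(J_{i,j})_{i,j\ge 1}$ be real numbers with $0\le K_{i,j}=K_{j,i}$, $0\le J_{i,j}=J_{j,i}$, $K_{i,j}\le\kappa_2(ij)^\alpha$ and $J_{i,j}\le\kappa_3(ij)^\alpha$ for all $i,j\ge1$ and some constants $\kappa_2,\kappa_3>0$. If $a^0,b^0\in X_1^+$, then the coagulation--annihilation system with rates $K$, $J$ and initial data $(a^0,b^0)$ possesses a unique solution $(a,b)$ on $[0,\infty)$ with $(a(t),b(t))\in X_1^+\times X_1^+$ for every $t\ge0$.
   Context: For $p\in\mathbb{R}$, $X_p$ is the space of real sequences $x=(x_i)_{i\ge1}$ with $\|x\|_p=\sum_{i=1}^\infty i^p|x_i|<\infty$, and $X_p^+=\{x\in X_p: x_i\ge0\text{ for all }i\ge1\}$. The coagulation--annihilation system is, for $i\in\mathbb{N}=\{1,2,\dots\}$ and $t>0$, $$\frac{da_i}{dt}=\frac12\sum_{j=1}^{i-1}K_{j,i-j}a_ja_{i-j}-\sum_{j=1}^\infty K_{i,j}a_ia_j-\sum_{j=1}^\infty J_{i,j}a_ib_j,\qquad \frac{db_i}{dt}=\frac12\sum_{j=1}^{i-1}K_{j,i-j}b_jb_{i-j}-\sum_{j=1}^\infty K_{i,j}b_ib_j-\sum_{j=1}^\infty J_{i,j}b_ia_j,$$ with $a_i(0)=a_i^0\ge0$, $b_i(0)=b_i^0\ge0$ (for $i=1$ the first sums are zero). Solution: for $T\in(0,\infty]$, a pair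 $(a,b)=((a_i)_{i\ge1},(b_i)_{i\ge1})$ of sequences of non-negative functions is a solution on $[0,T)$ with initial data $(a^0,b^0)$ if (1) $a_i,b_i\in C([0,T))$ for each $i\in\mathbb{N}$; (2) for each $i\in\mathbb{N}$ and $t\in[0,T)$, the functions $\sum_{j=1}^\infty K_{i,j}a_j$, $\sum_{j=1}^\infty K_{i,j}b_j$, $\sum_{j=1}^\infty J_{i,j}a_j$, $\sum_{j=1}^\infty J_{i,j}b_j$ belong to $L^1(0,t)$; (3) for each $i\in\mathbb{N}$ and $t\in(0,T)$, $$a_i(t)=a_i^0+\int_0^t\Big(\tfrac12\sum_{j=1}^{i-1}K_{j,i-j}a_j(s)a_{i-j}(s)-a_i(s)\sum_{j=1}^\infty K_{i,j}a_j(s)-a_i(s)\sum_{j=1}^\infty J_{i,j}b_j(s)\Big)ds,$$ $$b_i(t)=b_i^0+\int_0^t\Big(\tfrac12\sum_{j=1}^{i-1}K_{j,i-j}b_j(s)b_{i-j}(s)-b_i(s)\sum_{j=1}^\infty K_{i,j}b_j(s)-b_i(s)\sum_{j=1}^\infty J_{i,j}a_j(s)\Big)ds.$$ *)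

(* Defs.v *)
From HB Require Import structures.
From mathcomp Require Import all_boot all_order all_algebra.
From mathcomp Require Import all_classical all_reals all_analysis.

Set Implicit Arguments.
Unset Strict Implicit.
Unset Printing Implicit Defensive.

Import Order.TTheory GRing.Theory Num.Theory.
Import numFieldNormedType.Exports.

Local Open Scope classical_set_scope.
Local Open Scope ring_scope.

(* Sequences indexed by i >= 1 are encoded as functions on nat whose value
   at 0 is never used; likewise for the rates K and J. *)

Definition Xnorm (R : realType) (p : R) (x : nat -> R) : \bar R :=
  (\sum_(1 <= i <oo) ((i%:R `^ p) * `|x i|)%:E)%E.

Definition inX (R : realType) (p : R) (x : nat -> R) : Prop :=
  (Xnorm p x < +oo)%E.

Definition inXpos (R : realType) (p : R) (x : nat -> R) : Prop :=
  inX p x /\ (forall i : nat, (1 <= i)%N -> 0 <= x i).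

(* The infinite sums below are taken in \bar R: for nonnegative data a divergent
   sum is +oo, so that integrability of [rate_sum] is a genuine finiteness
   condition and makes the sum finite almost everywhere. *)
Definition rate_sum (R : realType) (K : nat -> nat -> R) (c : nat -> R -> R)
    (i : nat) (s : R) : \bar R :=
  (\sum_(1 <= j <oo) (K i j * c j s)%:E)%E.

(* The right-hand side for the species c; the annihilating species is d. *)
Definition coag_annih_rhs (R : realType) (K J : nat -> nat -> R)
    (c d : nat -> R -> R) (i : nat) (s : R) : \bar R :=
  ((2^-1 * \sum_(1 <= j < i) K j (i - j)%N * c j s * c (i - j)%N s)%:E
   - (c i s)%:E * rate_sum K c i s
   - (c i s)%:E * rate_sum J d i s)%E.

Record is_solution (R : realType) (K J : nat -> nat -> R) (T : \bar R)
    (a0 b0 : nat -> R) (a b : nat -> R -> R) : Prop := IsSolution {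
  sol_nonneg : forall (i : nat) (t : R), (1 <= i)%N -> 0 <= t -> (t%:E < T)%E ->
    0 <= a i t /\ 0 <= b i t ;
  sol_continuous : forall i : nat, (1 <= i)%N ->
    {within [set t : R | 0 <= t /\ (t%:E < T)%E], continuous (a i)} /\
    {within [set t : R | 0 <= t /\ (t%:E < T)%E], continuous (b i)} ;
  sol_integrable : forall (i : nat) (t : R),
    (1 <= i)%N -> 0 <= t -> (t%:E < T)%E ->
    [/\ lebesgue_measure.-integrable `]0, t[ (rate_sum K a i),
        lebesgue_measure.-integrable `]0, t[ (rate_sum K b i),
        lebesgue_measure.-integrable `]0, t[ (rate_sum J a i) &
        lebesgue_measure.-integrable `]0, t[ (rate_sum J b i)] ;
  sol_integral_eq : forall (i : nat) (t : R),
    (1 <= i)%N -> 0 < t -> (t%:E < T)%E ->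
    (a i t)%:E = ((a0 i)%:E
      + \int[lebesgue_measure]_(s in `]0%R, t[) coag_annih_rhs K J a b i s)%E /\
    (b i t)%:E = ((b0 i)%:E
      + \int[lebesgue_measure]_(s in `]0%R, t[) coag_annih_rhs K J b a i s)%E
}.

(* Main.v *)
(** Since [alpha <= 1/2] and [i j >= 1], both rates are bounded by
    [C sqrt i sqrt j], so only [alpha = 1/2] matters.  A bound [M] on the first
    moments makes the tails beyond [m] of the rate series at most
    [C sqrt i M / sqrt m], uniformly in time.

    Existence: explicit Euler schemes for kernels truncated at [N] preserve
    positivity and do not increase the mass, and each component is Lipschitz
    uniformly in [N].  Their limit along an ultrafilter exists pointwise without
    any compactness theorem in function spaces; by the uniform tails the
    right-hand sides converge too, so the limit is differentiable and solves the
    system.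

    Uniqueness: for the difference [u] of two solutions, testing with
    [sqrt i] times a smoothed sign of [u_i] for [i < n] bounds the growth of
    [sum_(i < n) sqrt i |u_i|] by a multiple of the full sum, because
    [sqrt (j + k) <= sqrt j + sqrt k] leaves the factor [2 sqrt j], and
    [K j k * sqrt j <= C j sqrt k].  Gronwall's argument concludes. *)
Require Import Defs.
From mathcomp Require Import all_boot all_order all_algebra.
From mathcomp Require Import all_classical all_reals all_analysis.
From mathcomp Require Import ring lra.

Set Implicit Arguments.
Unset Strict Implicit.
Unset Printing Implicit Defensive.

Import Order.TTheory GRing.Theory Num.Theory.
Import numFieldNormedType.Exports.

Local Open Scope classical_set_scope.
Local Open Scope ring_scope.

(** * Moment estimates *)

Section Algebra.
Variable R : realType.
Implicit Types (x y u phi : nat -> R) (K J : nat -> nat -> R) (C M : R).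

Definition rootn (i : nat) : R := Num.sqrt i%:R.

Lemma rootn_ge0 i : 0 <= rootn i.
Proof. exact: sqrtr_ge0. Qed.

Lemma rootn0 : rootn 0 = 0.
Proof. exact: sqrtr0. Qed.

Lemma rootn_gt0 i : (0 < i)%N -> 0 < rootn i.
Proof. by move=> i0; rewrite sqrtr_gt0 ltr0n. Qed.

Lemma rootnM i : rootn i * rootn i = i%:R.
Proof. by rewrite -expr2 sqr_sqrtr. Qed.

Lemma le_rootn i j : (i <= j)%N -> rootn i <= rootn j.
Proof. by move=> ij; rewrite ler_wsqrtr// ler_nat. Qed.

Lemma rootn_le i : rootn i <= i%:R.
Proof.
case: i => [|i]; first by rewrite rootn0.
rewrite -rootnM ler_peMl ?rootn_ge0//.
by rewrite -sqrtr1 ler_wsqrtr// ler1n.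
Qed.

Lemma rootnD i j : rootn (i + j) <= rootn i + rootn j.
Proof.
rewrite -(@ler_pXn2r _ 2)// ?nnegrE ?addr_ge0 ?rootn_ge0//.
rewrite expr2 rootnM natrD -!rootnM.
have := mulr_ge0 (rootn_ge0 i) (rootn_ge0 j); nra.
Qed.

(** Substitute [i = j + k]. The triangle [j + k < n] may be enlarged to the square [j, k < n]
    because [phi] vanishes from [n] on. *)
Lemma sum_convolution n (F : nat -> nat -> R) phi :
  (forall i, (n <= i)%N -> phi i = 0) ->
  \sum_(i < n) phi i * \sum_(j < i.+1) F j (i - j)%N =
  \sum_(j < n) \sum_(k < n) phi (j + k)%N * F j k.
Proof.
move=> phi0.
under eq_bigr => i _.
  rewrite big_distrr/= -(big_mkord xpredT (fun j => phi i * F j (i - j)%N)).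
  rewrite (big_nat_widen _ _ n)//= big_mkord.
  over.
rewrite (exchange_big_dep xpredT)//=; apply: eq_bigr => -[j jn] _ /=.
rewrite -(big_mkord xpredT (fun k => phi (j + k)%N * F j k)).
rewrite -(big_mkord (fun i => j < i.+1)%N (fun i => phi i * F j (i - j)%N)).
rewrite [RHS](big_cat_nat (leq0n (n - j)) (leq_subr j n))/=.
rewrite [X in _ = _ + X]big_nat_cond [X in _ = _ + X]big1 ?addr0; last first.
  by move=> k /andP[/andP[nk _] _]; rewrite phi0 ?mul0r// -leq_subLR.
rewrite -(big_nat_widenl j 0 n xpredT)//= -{1}[j]ssrnat.add0n big_addn.
by apply: eq_bigr => k _; rewrite addnK addnC.
Qed.

(** Bounding the partial sums instead of the series keeps the condition closed under componentwise
    limits. *)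
Definition nonneg_mass M x : Prop :=
  (forall i, 0 <= x i) /\ (forall n, \sum_(i < n) i%:R * x i <= M).

(** Since [rootn 0 = 0], such a kernel vanishes as soon as one index is 0. *)
Definition bounded_kernel C K : Prop :=
  forall i j, [/\ 0 <= K i j, K i j = K j i & K i j <= C * (rootn i * rootn j)].

Lemma sum_swap n (F : nat -> nat -> R) :
  \sum_(j < n) \sum_(k < n) F j k = 2^-1 * \sum_(j < n) \sum_(k < n) (F j k + F k j).
Proof.
under [in RHS]eq_bigr do rewrite big_split/=.
rewrite big_split/= [X in _ + X]exchange_big/=; lra.
Qed.

Lemma ler_sum_widen n m (F : nat -> R) : (n <= m)%N -> (forall i, 0 <= F i) ->
  \sum_(i < n) F i <= \sum_(i < m) F i.
Proof.
move=> nm F0; rewrite -!(big_mkord xpredT F) [leRHS](big_cat_nat (leq0n n) nm)/=.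
by rewrite lerDl sumr_ge0.
Qed.

(* Symmetrising, a pair [(j, k)] contributes [((j + k) - j - k) / 2 = 0] to the
   mass if [j + k < n], and a nonpositive amount otherwise. *)
Lemma truncated_mass_decreases C K x (A : nat -> R) n :
  bounded_kernel C K -> (forall i, 0 <= x i) ->
  (forall i, (i < n)%N -> \sum_(k < n) K i k * x k <= A i) ->
  \sum_(i < n) i%:R *
    (2^-1 * \sum_(j < i.+1) K j (i - j)%N * (x j * x (i - j)%N) - x i * A i) <= 0.
Proof.
move=> hK x0 hA.
pose phi i : R := if (i < n)%N then i%:R else 0.
rewrite (@le_trans _ _ (2^-1 * \sum_(j < n) \sum_(k < n) phi (j + k)%N * (K j k * (x j * x k)) -
   \sum_(j < n) \sum_(k < n) j%:R * (K j k * (x j * x k))))//.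
  rewrite -(@sum_convolution n (fun j k => K j k * (x j * x k)) phi); last by move=> i ni; rewrite /phi ltnNge ni.
  rewrite mulr_sumr -sumrB; apply: ler_sum => i _.
  rewrite /phi ltn_ord mulrBr mulrCA lerD2l lerN2 -mulr_sumr.
  rewrite ler_wpM2l// (le_trans _ (ler_wpM2l (x0 _) (hA _ (ltn_ord i))))//.
  by rewrite mulr_sumr; apply: ler_sum => k _; rewrite mulrCA.
rewrite (sum_swap n (fun j k => j%:R * (K j k * (x j * x k)))) -mulrBr mulr_ge0_le0// subr_le0.
apply: ler_sum => j _; apply: ler_sum => k _.
have [K0 Ks _] := hK j k.
rewrite -Ks [x k * x j]mulrC -mulrDl ler_wpM2r ?mulr_ge0// -natrD /phi.
by case: ifP.
Qed.

Section NonnegMass.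
Variables (M : R) (x : nat -> R).
Hypothesis hx : nonneg_mass M x.

Lemma nonneg_mass_ge0 i : 0 <= x i. Proof. by case: hx. Qed.

Lemma nonneg_mass_M_ge0 : 0 <= M.
Proof. by case: hx => _ /(_ 0); rewrite big_ord0. Qed.

Lemma rootn_sum_le n : \sum_(i < n) rootn i * x i <= M.
Proof.
apply: (le_trans _ (hx.2 n)); apply: ler_sum => i _.
by rewrite ler_wpM2r ?rootn_le ?nonneg_mass_ge0.
Qed.

Lemma rootn_term_le i : rootn i * x i <= M.
Proof.
apply: le_trans (rootn_sum_le i.+1); rewrite big_ord_recr/= lerDr.
by apply: sumr_ge0 => j _; rewrite mulr_ge0 ?rootn_ge0 ?nonneg_mass_ge0.
Qed.

(** For [j >= m] one has [rootn m * k j <= C * rootn j * rootn j = C * j], so [rootn m] times the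
    tail is at most [C] times the mass. *)
Lemma rate_tail (k : nat -> R) C m n : 0 <= C -> (forall j, 0 <= k j <= C * rootn j) ->
  (0 < m <= n)%N ->
  0 <= \sum_(j < n) k j * x j - \sum_(j < m) k j * x j <= C * M / rootn m.
Proof.
move=> C0 hk /andP[m0 mn].
rewrite -!(big_mkord xpredT (fun j => k j * x j)) (big_cat_nat (leq0n m) mn)/=.
rewrite addrAC subrr add0r; apply/andP; split.
  by apply: sumr_ge0 => j _; rewrite mulr_ge0 ?nonneg_mass_ge0//; case/andP: (hk j).
rewrite ler_pdivlMr ?rootn_gt0// mulrC.
apply: (@le_trans _ _ (C * \sum_(m <= j < n) j%:R * x j)).
  rewrite !mulr_sumr big_nat_cond [leRHS]big_nat_cond; apply: ler_sum => j.
  rewrite andbT => /andP[mj _].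
  rewrite !mulrA ler_wpM2r ?nonneg_mass_ge0//.
  have /andP[k0 kC] := hk j.
  apply: (@le_trans _ _ (rootn j * (C * rootn j))).
    by rewrite ler_pM ?rootn_ge0// le_rootn.
  by rewrite mulrCA rootnM.
rewrite ler_wpM2l//; apply: le_trans (hx.2 n).
rewrite -(big_mkord xpredT (fun j => j%:R * x j)) (big_cat_nat (leq0n m) mn)/=.
by rewrite lerDr sumr_ge0// => j _; rewrite mulr_ge0 ?nonneg_mass_ge0.
Qed.

End NonnegMass.

End Algebra.

(** * Rates and right-hand sides *)

Section Rates.
Variable R : realType.
Implicit Types (k x y u phi : nat -> R) (K J : nat -> nat -> R) (C D M : R).

Definition rate k x : R := limn (fun n => \sum_(j < n) k j * x j).

(** The gain sum includes [j = 0] and [j = i]; for a [bounded_kernel] these two terms are zero. *)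
Definition rhs K J x y i : R :=
  2^-1 * (\sum_(j < i.+1) K j (i - j)%N * (x j * x (i - j)%N))
  - x i * (rate (K i) x + rate (J i) y).

Section NonnegMassRate.
Variables (M C : R) (x k : nat -> R).
Hypotheses (hx : nonneg_mass M x) (C0 : 0 <= C) (hk : forall j, 0 <= k j <= C * rootn R j).

Lemma partial_rate_nondecreasing : nondecreasing_seq (fun n => \sum_(j < n) k j * x j).
Proof.
move=> m n mn; apply: (@ler_sum_widen _ _ _ (fun j => k j * x j)) => // j.
by rewrite mulr_ge0 ?(nonneg_mass_ge0 hx)//; case/andP: (hk j).
Qed.

Lemma partial_rate_le n : \sum_(j < n) k j * x j <= C * M.
Proof.
apply: (@le_trans _ _ (C * \sum_(j < n) rootn R j * x j)).
  rewrite mulr_sumr; apply: ler_sum => j _; rewrite mulrA ler_wpM2r ?(nonneg_mass_ge0 hx)//.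
  by case/andP: (hk j).
by rewrite ler_wpM2l ?(rootn_sum_le hx).
Qed.

Lemma rate_cvg : (fun n => \sum_(j < n) k j * x j) @ \oo --> rate k x.
Proof.
suff : cvgn (fun n => \sum_(j < n) k j * x j) by [].
apply: nondecreasing_is_cvgn; first exact: partial_rate_nondecreasing.
by exists (C * M) => _ [n _ <-]; exact: partial_rate_le.
Qed.

Lemma partial_rate_le_rate n : \sum_(j < n) k j * x j <= rate k x.
Proof.
apply: (nondecreasing_cvgn_le partial_rate_nondecreasing).
by apply/cvg_ex; exists (rate k x); exact: rate_cvg.
Qed.

Lemma rate_le : rate k x <= C * M.
Proof.
apply: (cvgr_to_le rate_cvg); apply: nearW => n; exact: partial_rate_le.
Qed.

Lemma rate_ge0 : 0 <= rate k x.
Proof. by apply: le_trans (partial_rate_le_rate 0); rewrite big_ord0. Qed.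

Lemma rate_truncation m : (0 < m)%N ->
  `|rate k x - \sum_(j < m) k j * x j| <= C * M / rootn R m.
Proof.
move=> m0; rewrite ger0_norm ?subr_ge0 ?partial_rate_le_rate//.
have h : (fun n => \sum_(j < n) k j * x j - \sum_(j < m) k j * x j) @ \oo -->
   rate k x - \sum_(j < m) k j * x j.
  by apply: cvgB; [exact: rate_cvg | exact: cvg_cst].
apply: (cvgr_to_le h); near=> n.
have mn : (0 < m <= n)%N by rewrite m0/=; near: n; exact: nbhs_infty_ge.
by case/andP : (rate_tail hx C0 hk mn).
Unshelve. all: by end_near. Qed.

End NonnegMassRate.

Lemma rootn_tail_small D e : 0 <= D -> 0 < e -> exists2 m, (0 < m)%N & D / rootn R m < e.
Proof.
(* This [m] exceeds [(D / e)^2], so [rootn m > D / e]. *)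
move=> D0 e0; exists (Num.truncn ((D / e) ^+ 2)).+1 => //.
rewrite ltr_pdivrMr ?rootn_gt0// mulrC -ltr_pdivrMr//.
rewrite -(@ltr_pXn2r _ 2)// ?nnegrE ?rootn_ge0 ?divr_ge0 ?(ltW e0)//.
rewrite [ltRHS]expr2 rootnM; exact: truncnS_gt.
Qed.

(* Interchange of limits: the tails of the series are small uniformly along [F]. *)
Lemma cvg_rate (T : Type) (F : set_system T) (FF : Filter F) (A : T -> R) (a : R)
    (KF X : T -> nat -> R) k x D : 0 <= D ->
  (forall j, KF s j @[s --> F] --> k j) -> (forall j, X s j @[s --> F] --> x j) ->
  (forall m, (0 < m)%N -> forall s, `|A s - \sum_(j < m) KF s j * X s j| <= D / rootn R m) ->
  (forall m, (0 < m)%N -> `|a - \sum_(j < m) k j * x j| <= D / rootn R m) ->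
  A s @[s --> F] --> a.
Proof.
move=> D0 hK hX hA ha; apply/cvgrPdist_lt => e e0.
have [m m0 hm] := rootn_tail_small D0 (divr_gt0 e0 (ltr0n R 3)).
have /cvgrPdist_lt/(_ _ (divr_gt0 e0 (ltr0n R 3))) hS :
    \sum_(j < m) KF s j * X s j @[s --> F] --> \sum_(j < m) k j * x j.
  apply: cvg_big => // [|j _]; first by move=> z; exact: add_continuous.
  exact: cvgM.
have ham := ha _ m0.
near=> s.
have h1 := hA m m0 s.
have h2 : `|\sum_(j < m) k j * x j - \sum_(j < m) KF s j * X s j| < e / 3 by near: s.
move: h1 h2 ham; rewrite !ler_norml !ltr_norml => /andP[? ?] /andP[? ?] /andP[? ?].
lra.
Unshelve. all: by end_near. Qed.

Lemma kernel_row C K i : bounded_kernel C K -> forall j, 0 <= K i j <= C * rootn R i * rootn R j.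
Proof. by move=> hK j; have [-> _] := hK i j; rewrite mulrA. Qed.

Section Rhs.
Variables (M C : R) (K J : nat -> nat -> R) (x y : nat -> R).
Hypotheses (C0 : 0 <= C) (hK : bounded_kernel C K) (hJ : bounded_kernel C J).
Hypotheses (hx : nonneg_mass M x) (hy : nonneg_mass M y).

Let Ci0 i : 0 <= C * rootn R i. Proof. by rewrite mulr_ge0 ?rootn_ge0. Qed.

(** Annihilation only enlarges the loss, and the full coagulation rate dominates its first [n]
    terms, so the total rate can serve as [A] in [truncated_mass_decreases]. *)
Lemma rhs_mass_le0 n : \sum_(i < n) i%:R * rhs K J x y i <= 0.
Proof.
apply: (@truncated_mass_decreases _ _ _ _ (fun i => rate (K i) x + rate (J i) y) n hK) => [i|i _]; first exact: (nonneg_mass_ge0 hx).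
apply: (le_trans (partial_rate_le_rate hx (Ci0 i) (kernel_row i hK) _)).
by rewrite lerDl (rate_ge0 hy (Ci0 i) (kernel_row i hJ)).
Qed.

(** Every [rootn j * x j] is at most [M], so each of the [i + 1] gain terms and each of the two loss
    terms is at most [C * M ^+ 2]. *)
Lemma rhs_bound i : `|rhs K J x y i| <= (i + 3)%:R * (C * M ^+ 2).
Proof.
have M0 := nonneg_mass_M_ge0 hx.
have CM0 : 0 <= C * M ^+ 2 by rewrite mulr_ge0 ?exprn_ge0.
have hsum : 0 <= \sum_(j < i.+1) K j (i - j)%N * (x j * x (i - j)%N) <= i.+1%:R * (C * M ^+ 2).
  apply/andP; split.
    apply: sumr_ge0 => j _; have [? _ _] := hK j (i - j)%N.
    by rewrite !mulr_ge0 ?(nonneg_mass_ge0 hx).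
  rewrite -[X in X%:R](card_ord i.+1) mulr_natl -sumr_const; apply: ler_sum => j _.
  have [? _ hle] := hK j (i - j)%N.
  apply: (le_trans (ler_wpM2r _ hle)); first by rewrite mulr_ge0 ?(nonneg_mass_ge0 hx).
  rewrite [leLHS](_ : _ = C * ((rootn R j * x j) * (rootn R (i - j) * x (i - j)%N))); last by ring.
  rewrite ler_wpM2l// expr2.
  by apply: ler_pM; rewrite ?(rootn_term_le hx)// mulr_ge0 ?rootn_ge0 ?(nonneg_mass_ge0 hx).
have hr : 0 <= x i * (rate (K i) x + rate (J i) y) <= 2 * (C * M ^+ 2).
  have r1 := rate_ge0 hx (Ci0 i) (kernel_row i hK).
  have r2 := rate_ge0 hy (Ci0 i) (kernel_row i hJ).
  have r3 := rate_le hx (Ci0 i) (kernel_row i hK).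
  have r4 := rate_le hy (Ci0 i) (kernel_row i hJ).
  rewrite mulr_ge0 ?addr_ge0 ?(nonneg_mass_ge0 hx)//=.
  apply: (@le_trans _ _ (x i * (2 * (C * rootn R i * M)))).
    by rewrite ler_wpM2l ?(nonneg_mass_ge0 hx)//; lra.
  rewrite (_ : _ * _ = 2 * (C * (rootn R i * x i * M))); last by ring.
  by rewrite !ler_wpM2l// expr2 ler_wpM2r ?(rootn_term_le hx).
rewrite -natr1 in hsum; rewrite /rhs ler_norml natrD.
move: hsum hr => /andP[? ?] /andP[? ?].
have ? : 0 <= i%:R * (C * M ^+ 2) by rewrite mulr_ge0.
by apply/andP; split; lra.
Qed.

End Rhs.

(** The kernels may vary along the filter as well: this covers both the truncated kernels of the
    Euler schemes and, with constant kernels, continuity in time. *)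
Lemma cvg_rhs (T : Type) (F : set_system T) (FF : Filter F) M C (K J : nat -> nat -> R)
    (KF JF : T -> nat -> nat -> R) (X Y : T -> nat -> R) x y i :
  0 <= C -> bounded_kernel C K -> bounded_kernel C J ->
  (forall s, bounded_kernel C (KF s)) -> (forall s, bounded_kernel C (JF s)) ->
  (forall i j, KF s i j @[s --> F] --> K i j) -> (forall i j, JF s i j @[s --> F] --> J i j) ->
  (forall s, nonneg_mass M (X s)) -> (forall s, nonneg_mass M (Y s)) ->
  nonneg_mass M x -> nonneg_mass M y ->
  (forall j, X s j @[s --> F] --> x j) -> (forall j, Y s j @[s --> F] --> y j) ->
  rhs (KF s) (JF s) (X s) (Y s) i @[s --> F] --> rhs K J x y i.
Proof.
move=> C0 hK hJ hKF hJF KFK JFJ hX hY hx hy Xx Yy.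
have M0 := nonneg_mass_M_ge0 hx.
have Ci0 : 0 <= C * rootn R i by rewrite mulr_ge0 ?rootn_ge0.
apply: cvgB.
  apply: cvgM; first exact: cvg_cst.
  apply: cvg_big => // [|j _]; first by move=> z; exact: add_continuous.
  by apply: cvgM => //; exact: cvgM.
apply: cvgM => //; apply: cvgD.
- apply: (@cvg_rate _ _ _ _ _ (fun s => KF s i) X (K i) x (C * rootn R i * M)) => //.
  + by rewrite mulr_ge0.
  + by move=> m m0 s; exact: (rate_truncation (hX s) Ci0 (kernel_row i (hKF s))).
  + by move=> m m0; exact: (rate_truncation hx Ci0 (kernel_row i hK)).
- apply: (@cvg_rate _ _ _ _ _ (fun s => JF s i) Y (J i) y (C * rootn R i * M)) => //.
  + by rewrite mulr_ge0.
  + by move=> m m0 s; exact: (rate_truncation (hY s) Ci0 (kernel_row i (hJF s))).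
  + by move=> m m0; exact: (rate_truncation hy Ci0 (kernel_row i hJ)).
Qed.

End Rates.

(** * Existence *)

Section UltraLimit.
Variable R : realType.

(** Compactness of the segment gives a cluster point. An ultrafilter contains the preimage of each
    neighbourhood or of its complement, and clustering rules out the latter. *)
Lemma ultra_bounded_cvg (T : Type) (U : set_system T) (UU : UltraFilter U) (f : T -> R) a b :
  (forall s, a <= f s <= b) -> cvg (f @ U).
Proof.
move=> fab; apply/cvg_ex.
have [p [_ hp]] : `[a, b] `&` cluster (f @ U) !=set0.
  have PF : ProperFilter (f @ U) by apply: fmap_proper_filter.
  apply: (@segment_compact R a b (f @ U)).
  by apply: (@filterE _ U) => s; rewrite /= in_itv/=.
exists p => B Bp; case: (in_ultra_setVsetC (f @^-1` B) UU) => [//|nB].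
have [z [/= nz Bz]] := hp (~` B) B nB Bp.
by case: nz.
Qed.

(** Estimates on increments, free of quotients, pass to the limit directly from the Euler
    schemes. *)
Lemma is_derive1_of_increments (f : R -> R) (t v : R) :
  (forall e, 0 < e -> exists2 d, 0 < d &
     forall s, `|s - t| < d -> `|f s - f t - (s - t) * v| <= e * `|s - t|) ->
  is_derive t 1 f v.
Proof.
move=> hf.
have h : (fun h => h^-1 *: ((f \o shift t) (h *: (1 : R)) - f t)) @ 0^' --> v.
  apply/cvgrPdist_le => e e0; have [d d0 hd] := hf e e0.
  near=> h.
  have hn0 : h != 0 by near: h; exact: nbhs_dnbhs_neq.
  have hd' : `|h| < d.
    near: h; apply: dnbhs0_lt => //.
  rewrite /= /shift/= [h *: 1]mulr1 /GRing.scale/=.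
  have := hd (h + t); rewrite addrK => /(_ hd') hh.
  rewrite (_ : _ - _ = - (h^-1 * (f (h + t) - f t - h * v))); last first.
    by rewrite [in RHS]mulrBr mulrA mulVf// mul1r opprB.
  by rewrite normrN normrM normfV mulrC ler_pdivrMr ?normr_gt0.
by apply: DeriveDef; [apply/cvg_ex; exists v | exact/cvg_lim].
Unshelve. all: by end_near. Qed.

End UltraLimit.

(** * Explicit Euler schemes for truncated kernels *)

Section Euler.
Variable R : realType.
Variables (M C : R) (K J : nat -> nat -> R) (c0 : bool -> nat -> R).
Hypotheses (C0 : 0 <= C) (hK : bounded_kernel C K) (hJ : bounded_kernel C J).
Hypothesis hc0 : forall b, nonneg_mass M (c0 b).

Definition truncated_kernel (N : nat) (L : nat -> nat -> R) i j : R :=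
  if (i < N)%N && (j < N)%N then L i j else 0.

Lemma bounded_truncated_kernel N L : bounded_kernel C L -> bounded_kernel C (truncated_kernel N L).
Proof.
move=> hL i j; rewrite /truncated_kernel andbC; case: ifP => _; first exact: hL.
by rewrite !mulr_ge0 ?rootn_ge0.
Qed.

(** The constant no longer depends on the row [i], so one step size serves all components. *)
Lemma truncated_kernel_row N L : bounded_kernel C L ->
  forall i j, 0 <= truncated_kernel N L i j <= C * rootn R N * rootn R j.
Proof.
move=> hL i j; rewrite /truncated_kernel; case: ifP => [/andP[iN _]|_]; last first.
  by rewrite !mulr_ge0 ?rootn_ge0 ?lexx.
have [-> _ /= hle] := hL i j; apply: (le_trans hle).
by rewrite -mulrA ler_wpM2l// ler_wpM2r ?rootn_ge0// le_rootn// ltnW.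
Qed.

Let M0 : 0 <= M. Proof. exact: (nonneg_mass_M_ge0 (hc0 true)). Qed.

(* So small that the loss in one explicit Euler step is at most the whole
   population, although the rates grow like [sqrt N]. *)
Definition euler_step N : R := (2 * (C * rootn R N * M) + N.+1%:R)^-1.

Lemma euler_step_gt0 N : 0 < euler_step N.
Proof.
by rewrite invr_gt0 ltr_wpDl ?ltr0n// !mulr_ge0 ?rootn_ge0.
Qed.

Lemma euler_step_loss N : euler_step N * (2 * (C * rootn R N * M)) <= 1.
Proof.
have h : 0 <= C * rootn R N * M by rewrite !mulr_ge0 ?rootn_ge0.
by rewrite mulrC ler_pdivrMr ?mul1r ?lerDl// ltr_wpDl ?ltr0n// mulr_ge0.
Qed.

(** The summand [N.+1] in [euler_step] bounds it by the harmonic sequence, even if [C * M = 0]. *)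
Lemma euler_step_cvg0 : euler_step @ \oo --> 0.
Proof.
apply: (@squeeze_cvgr _ _ _ _ (fun=> 0) (@harmonic R)); last 2 first.
- exact: cvg_cst.
- exact: cvg_harmonic.
apply: nearW => N; rewrite ltW ?euler_step_gt0//= lef_pV2 ?posrE ?ltr0n//.
  by rewrite lerDr !mulr_ge0 ?rootn_ge0.
by rewrite ltr_wpDl ?ltr0n// !mulr_ge0 ?rootn_ge0.
Qed.

Fixpoint euler (N n : nat) : bool -> nat -> R :=
  if n is m.+1 then fun b i => euler N m b i + euler_step N *
    rhs (truncated_kernel N K) (truncated_kernel N J) (euler N m b) (euler N m (~~ b)) i
  else c0.

Lemma euler_nonneg_mass N n b : nonneg_mass M (euler N n b).
Proof.
elim: n b => [//|n IH] b /=.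
have hKN := bounded_truncated_kernel N hK; have hJN := bounded_truncated_kernel N hJ.
set x := euler N n b; set y := euler N n (~~ b).
have hx : nonneg_mass M x by exact: IH.
have hy : nonneg_mass M y by exact: IH.
have CN0 : 0 <= C * rootn R N by rewrite mulr_ge0 ?rootn_ge0.
split=> [i|k].
  have x0 := nonneg_mass_ge0 hx i; have h0 := euler_step_gt0 N.
  set A := rate (truncated_kernel N K i) x + rate (truncated_kernel N J i) y.
  have A0 : 0 <= A <= 2 * (C * rootn R N * M).
    have r1 := rate_ge0 hx CN0 (truncated_kernel_row N hK i).
    have r2 := rate_ge0 hy CN0 (truncated_kernel_row N hJ i).
    have r3 := rate_le hx CN0 (truncated_kernel_row N hK i).
    have r4 := rate_le hy CN0 (truncated_kernel_row N hJ i).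
    by rewrite /A; apply/andP; split; lra.
  rewrite /rhs -/A; set S := \sum_(_ < _) _.
  have S0 : 0 <= S.
    apply: sumr_ge0 => j _; have [? _ _] := hKN j (i - j)%N.
    by rewrite !mulr_ge0 ?(nonneg_mass_ge0 hx).
  (* Nonnegativity: the new value is a gain plus the fraction of [x i] surviving the loss, and
     [euler_step_loss] makes that fraction nonnegative. *)
  rewrite (_ : _ + _ = euler_step N * (2^-1 * S) + x i * (1 - euler_step N * A)); last by ring.
  rewrite addr_ge0 ?mulr_ge0 ?(ltW h0)// subr_ge0.
  apply: le_trans (euler_step_loss N); rewrite ler_wpM2l ?(ltW h0)//.
  by case/andP: A0.
apply: le_trans (hx.2 k).
under eq_bigr do rewrite mulrDr mulrCA.
rewrite big_split/= -mulr_sumr gerDl mulr_ge0_le0 ?(ltW (euler_step_gt0 N))//.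
exact: (rhs_mass_le0 C0 hKN hJN hx hy).
Qed.

Definition lipc i : R := (i + 3)%:R * (C * M ^+ 2).

Lemma lipc_ge0 i : 0 <= lipc i.
Proof. by rewrite /lipc !mulr_ge0 ?exprn_ge0. Qed.

Lemma euler_lipschitz N m n b i : (m <= n)%N ->
  `|euler N n b i - euler N m b i| <= lipc i * ((n - m)%:R * euler_step N).
Proof.
move=> /subnKC <-; rewrite addKn; elim: (n - m)%N => [|k IH].
  by rewrite addn0 subrr normr0 mul0r mulr0.
rewrite addnS/= addrAC (le_trans (ler_normD _ _))// -natr1 mulrDl mul1r mulrDr lerD//.
rewrite normrM gtr0_norm ?euler_step_gt0// mulrC ler_wpM2r ?(ltW (euler_step_gt0 N))//.
by apply: rhs_bound => //; [exact: bounded_truncated_kernel..|exact: euler_nonneg_mass|exact: euler_nonneg_mass].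
Qed.

(** [truncn] is 0 on negative numbers, so a path sits at its initial value for [t <= 0]. *)
Definition step_index N (t : R) : nat := Num.truncn (t / euler_step N).

Lemma step_index_le N t : 0 <= t -> (step_index N t)%:R * euler_step N <= t.
Proof.
by move=> t0; rewrite -ler_pdivlMr ?euler_step_gt0// truncn_le divr_ge0 ?(ltW (euler_step_gt0 N)).
Qed.

Lemma step_index_gt N t : t - euler_step N < (step_index N t)%:R * euler_step N.
Proof.
have := truncnS_gt (t / euler_step N); rewrite ltr_pdivrMr ?euler_step_gt0// -natr1 mulrDl mul1r.
by rewrite ltrBlDr.
Qed.

Lemma step_index_mono N s t : s <= t -> (step_index N s <= step_index N t)%N.
Proof. by move=> st; rewrite le_truncn// ler_wpM2r// invr_ge0 ltW ?euler_step_gt0. Qed.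

Lemma step_indexB N s t : s <= t ->
  (step_index N t - step_index N s)%:R * euler_step N <= t - s + euler_step N.
Proof.
move=> st; have h0 := euler_step_gt0 N; rewrite natrB ?step_index_mono// mulrBl.
have [t0|t0] := ltP t 0; last first.
  have := step_index_le N t0; have := step_index_gt N s; lra.
have : (step_index N t)%:R * euler_step N = 0.
  rewrite /step_index (_ : Num.truncn _ = 0%N) ?mul0r//; apply/truncn0Pn.
  by rewrite -ltNge (lt_trans _ ltr01)// pmulr_llt0// invr_gt0.
have : 0 <= (step_index N s)%:R * euler_step N by rewrite mulr_ge0 ?(ltW h0).
lra.
Qed.

Lemma step_index_id N k : step_index N (k%:R * euler_step N) = k.
Proof. by rewrite /step_index mulfK ?gt_eqF ?euler_step_gt0// natrK. Qed.

Definition euler_path N t b i : R := euler N (step_index N t) b i.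

(** The paths are step functions, hence Lipschitz only up to one step. The constant does not depend
    on [N]. *)
Lemma euler_path_lipschitz N s t b i : `|euler_path N t b i - euler_path N s b i| <= lipc i * (`|t - s| + euler_step N).
Proof.
wlog st : s t / s <= t.
  move=> H; have [/H//|/ltW/H] := leP s t.
  by rewrite distrC [`|s - t|]distrC.
rewrite (le_trans (euler_lipschitz _ _ _ (step_index_mono N st)))// ler_wpM2l ?lipc_ge0//.
by rewrite ger0_norm ?subr_ge0// step_indexB.
Qed.

End Euler.

(* The species are indexed by [b : bool], so that [~~ b] is the one annihilating
   [b]; a solution is continued to [t <= 0] by its initial value. *)
Definition coag_annih_ode (R : realType) (M : R) (K J : nat -> nat -> R)
    (c0 : bool -> nat -> R) (c : bool -> nat -> R -> R) : Prop :=
  [/\ forall b (t : R), nonneg_mass M (fun i => c b i t),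
      forall b i (t : R), t <= 0 -> c b i t = c0 b i,
      forall b i, continuous (c b i) &
      forall b i (t : R), 0 < t -> is_derive t 1 (c b i)
        (rhs K J (fun j => c b j t) (fun j => c (~~ b) j t) i)].

(** * The limit of the Euler schemes along an ultrafilter *)

Section Existence.
Variable R : realType.
Variables (M C : R) (K J : nat -> nat -> R) (c0 : bool -> nat -> R).
Hypotheses (C0 : 0 <= C) (hK : bounded_kernel C K) (hJ : bounded_kernel C J).
Hypothesis hc0 : forall b, nonneg_mass M (c0 b).
Variable U : set_system nat.
Hypotheses (UU : UltraFilter U) (hU : \oo `<=` U).

Local Notation A := (euler_path M C K J c0).
Local Notation h := (euler_step M C).
Local Notation L := (lipc M C).

Let M0 : 0 <= M. Proof. exact: (nonneg_mass_M_ge0 (hc0 true)). Qed.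

Let L0 i : 0 <= L i. Proof. exact: lipc_ge0 C0 hc0 i. Qed.

Definition ultralimit b i t : R := lim (A N t b i @[N --> U]).
Local Notation c := ultralimit.

Let hA N t b : nonneg_mass M (A N t b).
Proof. exact: (euler_nonneg_mass C0 hK hJ hc0). Qed.

Let alip := euler_path_lipschitz C0 hK hJ hc0.

Lemma euler_step_le1 N : h N <= 1.
Proof.
have X0 : 0 <= 2 * (C * rootn R N * M) by rewrite !mulr_ge0 ?rootn_ge0.
have N1 : 1 <= N.+1%:R :> R by rewrite ler1n.
by rewrite invf_le1; lra.
Qed.

Lemma euler_path_nonpos N t b i : t <= 0 -> A N t b i = c0 b i.
Proof.
move=> t0; rewrite /euler_path (_ : step_index _ _ _ _ = 0%N)//.
apply/truncn0Pn; rewrite -ltNge (le_lt_trans _ ltr01)// mulr_le0_ge0// invr_ge0 ltW//.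
exact: (euler_step_gt0 C0 hc0).
Qed.

Lemma euler_path_cvg t b i : A N t b i @[N --> U] --> c b i t.
Proof.
suff : cvg (A N t b i @[N --> U]) by [].
(* Comparison with time 0 gives a bound uniform in [N], as every step is at most 1. *)
pose B := L i * (`|t| + 1).
apply: (@ultra_bounded_cvg _ _ _ _ _ (c0 b i - B) (c0 b i + B)) => N.
have := alip N 0 t b i; rewrite subr0 (euler_path_nonpos _ _ _ (lexx 0)).
have : L i * (`|t| + h N) <= B by rewrite /B ler_wpM2l ?L0// lerD2l euler_step_le1.
rewrite ler_norml => ? /andP[? ?]; apply/andP; split; lra.
Qed.

Lemma stepU_cvg0 : h N @[N --> U] --> 0.
Proof.
by move=> B /(euler_step_cvg0 C0 hc0); exact: hU.
Qed.

Lemma ultralimit_nonneg_mass b t : nonneg_mass M (fun i => c b i t).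
Proof.
split=> [i|n].
  by apply: (cvgr_to_ge (@euler_path_cvg t b i)); apply: nearW => N; exact: (nonneg_mass_ge0 (hA N t b)).
have hs : \sum_(i < n) i%:R * A N t b i @[N --> U] --> \sum_(i < n) i%:R * c b i t.
  apply: cvg_big => // [|i _]; first by move=> z; exact: add_continuous.
  by apply: cvgM; [exact: cvg_cst|exact: euler_path_cvg].
by apply: (cvgr_to_le hs); apply: nearW => N; exact: (hA N t b).2.
Qed.

Lemma ultralimit_nonpos b i t : t <= 0 -> c b i t = c0 b i.
Proof.
move=> t0; apply: cvg_lim => //.
under eq_fun do rewrite (euler_path_nonpos _ _ _ t0).
exact: cvg_cst.
Qed.

Lemma ultralimit_lipschitz b i s t : `|c b i t - c b i s| <= L i * `|t - s|.
Proof.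
rewrite -subr_ge0.
have hl : L i * (`|t - s| + h N) - `|A N t b i - A N s b i| @[N --> U] -->
    L i * (`|t - s| + 0) - `|c b i t - c b i s|.
  apply: cvgB.
    apply: cvgM; first exact: cvg_cst.
    by apply: cvgD; [exact: cvg_cst|exact: stepU_cvg0].
  by apply: cvg_norm; apply: cvgB; exact: euler_path_cvg.
rewrite addr0 in hl; apply: (cvgr_to_ge hl); apply: nearW => N.
by rewrite subr_ge0 alip.
Qed.

Lemma ultralimit_continuous b i : continuous (c b i).
Proof.
move=> t; apply/cvgrPdist_le => e e0.
have L1 : 0 < L i + 1 by rewrite ltr_wpDl// L0.
near=> s.
rewrite (le_trans (ultralimit_lipschitz _ _ _ _))//.
apply: (@le_trans _ _ ((L i + 1) * `|t - s|)); first by rewrite ler_wpM2r// lerDl.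
rewrite mulrC -ler_pdivlMr//; near: s.
by apply: (@cvgr_dist_le _ _ _ _ _ id t) => //; rewrite divr_gt0.
Unshelve. all: by end_near. Qed.

(* The approximations converge locally uniformly because they are equi-Lipschitz
   up to the vanishing step; hence so do their right-hand sides. *)
Lemma euler_path_cvg_joint t b i :
  A p.1 p.2 b i @[p --> filter_prod U (nbhs t)] --> c b i t.
Proof.
apply/cvgrPdist_le => e e0.
have L1 : 0 < L i + 1 by rewrite ltr_wpDl// L0.
have e3 : 0 < e / 3 by rewrite divr_gt0.
have d0 : 0 < e / 3 / (L i + 1) by rewrite divr_gt0.
exists ([set N | `|c b i t - A N t b i| <= e / 3 /\ `|0 - h N| <= e / 3 / (L i + 1)],
        [set s | `|t - s| <= e / 3 / (L i + 1)]).
  split => /=.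
    apply: filterI.
      exact: (@cvgr_dist_le _ _ _ _ _ _ _ (@euler_path_cvg t b i) _ e3).
    exact: (@cvgr_dist_le _ _ _ _ _ _ _ stepU_cvg0 _ d0).
  exact: (@cvgr_dist_le _ _ _ (nbhs t) _ id t cvg_id _ d0).
move=> [N s] /= [[h1 h2] h3].
have := alip N s t b i; rewrite sub0r normrN gtr0_norm ?(euler_step_gt0 C0 hc0)// in h2.
move=> h4.
have h5 : L i * (`|t - s| + h N) <= (L i + 1) * (e / 3 / (L i + 1) + e / 3 / (L i + 1)).
  apply: ler_pM; rewrite ?L0 ?addr_ge0 ?(ltW (euler_step_gt0 C0 hc0 N)) ?lerD ?lexx//.
  by rewrite lerDl.
rewrite [leRHS]mulrDr [_ * (e / 3 / _)]mulrC divfK ?gt_eqF// in h5.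
move: h1 (le_trans h4 h5); rewrite !ler_norml => /andP[? ?] /andP[? ?].
apply/andP; split; lra.
Qed.

Lemma rhs_euler_path_cvg_joint t b i :
  rhs (truncated_kernel p.1 K) (truncated_kernel p.1 J) (A p.1 p.2 b) (A p.1 p.2 (~~ b)) i
    @[p --> filter_prod U (nbhs t)] -->
  rhs K J (fun j => c b j t) (fun j => c (~~ b) j t) i.
Proof.
have trunc_cvg (Q : nat -> nat -> R) j k :
    truncated_kernel p.1 Q j k @[p --> filter_prod U (nbhs t)] --> Q j k.
  (* Each entry equals that of the full kernel once [N] exceeds both indices. *)
  apply: cvg_near_cst; exists ([set N | (maxn j k < N)%N], setT).
    split; last exact: filterT.
    by apply: hU; exact: nbhs_infty_gt.
  by move=> [N s] /= [+ _]; rewrite gtn_max /truncated_kernel => /andP[-> ->].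
apply: (@cvg_rhs _ _ _ _ M C _ _ _ _ (fun p => A p.1 p.2 b) (fun p => A p.1 p.2 (~~ b))) => //.
- by move=> p; exact: bounded_truncated_kernel.
- by move=> p; exact: bounded_truncated_kernel.
- exact: ultralimit_nonneg_mass.
- exact: ultralimit_nonneg_mass.
- by move=> j; exact: euler_path_cvg_joint.
- by move=> j; exact: euler_path_cvg_joint.
Qed.

(** Every Euler step between [r1] and [r2] has slope within [e] of [v]. Rounding both endpoints to
    the grid changes the elapsed time by at most [h N], which accounts for the terms [e * h N] and
    [|v| * h N]. The slopes are taken at grid times, the first of which may precede [r1] by less
    than one step. *)
Lemma euler_path_increment N r1 r2 b i v e : 0 <= r1 <= r2 -> 0 <= e ->
  (forall s, r1 - h N <= s <= r2 ->
    `|rhs (truncated_kernel N K) (truncated_kernel N J) (A N s b) (A N s (~~ b)) i - v| <= e) ->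
  `|A N r2 b i - A N r1 b i - (r2 - r1) * v| <= e * (r2 - r1 + h N) + `|v| * h N.
Proof.
move=> /andP[r10 r12] e0 hs.
have h0 := euler_step_gt0 C0 hc0 N.
pose n1 := step_index M C N r1; pose n2 := step_index M C N r2.
have n12 : (n1 <= n2)%N by exact: step_index_mono C0 hc0 _ _ _ r12.
pose E n := euler M C K J c0 N n b i.
have key k : (n1 + k <= n2)%N -> `|E (n1 + k)%N - E n1 - k%:R * h N * v| <= e * (k%:R * h N).
  elim: k => [|k IH] hk.
    by rewrite addn0 subrr !mul0r subr0 normr0 mulr0.
  rewrite addnS in hk *.
  have i1 := step_index_gt C0 hc0 N r1; have i2 := step_index_le C0 hc0 N (le_trans r10 r12).
  have /hs : r1 - h N <= (n1 + k)%:R * h N <= r2.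
    rewrite (le_trans (ltW i1)) ?ler_wpM2r ?(ltW h0) ?ler_nat ?leq_addr//=.
    by rewrite (le_trans _ i2)// ler_wpM2r ?(ltW h0)// ler_nat ltnW.
  rewrite /euler_path (step_index_id C0 hc0) => hr.
  rewrite /E/= -/(E (n1 + k)%N) -/(E n1); set r := rhs _ _ _ _ _ in hr *.
  rewrite (_ : _ - _ - _ = E (n1 + k)%N - E n1 - k%:R * h N * v + h N * (r - v)); last first.
    by rewrite -natr1; ring.
  have -> : e * (k.+1%:R * h N) = e * (k%:R * h N) + e * h N by rewrite -natr1; ring.
  apply: (le_trans (ler_normD _ _)); apply: lerD; first exact: (IH (ltnW hk)).
  by rewrite normrM gtr0_norm// mulrC ler_wpM2r ?(ltW h0).
have := key (n2 - n1)%N; rewrite subnKC// => /(_ (leqnn _)) hE.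
have i1 := step_index_gt C0 hc0 N r1; have i2 := step_index_gt C0 hc0 N r2.
have i3 := step_index_le C0 hc0 N r10; have i4 := step_index_le C0 hc0 N (le_trans r10 r12).
rewrite natrB// mulrBl in hE.
(* [D] is the time covered by the grid steps. *)
set D := n2%:R * h N - n1%:R * h N in hE.
have D1 : `|D - (r2 - r1)| <= h N.
  by rewrite ler_norml /D /n1 /n2; apply/andP; split; lra.
rewrite (_ : A N r2 b i - _ - _ = (E n2 - E n1 - D * v) + (D - (r2 - r1)) * v); last first.
  by rewrite /E /euler_path -/n1 -/n2; ring.
rewrite (le_trans (ler_normD _ _))// lerD//.
  rewrite (le_trans hE)// ler_wpM2l// -lerBlDl.
  by move: D1; rewrite ler_norml => /andP[_].
by rewrite normrM mulrC ler_wpM2l.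
Qed.

Lemma ultralimit_is_derive b i (t : R) : 0 < t ->
  is_derive t 1 (c b i) (rhs K J (fun j => c b j t) (fun j => c (~~ b) j t) i).
Proof.
move=> t0; set v := rhs _ _ _ _ _.
apply: is_derive1_of_increments => e e0.
have := @cvgr_distC_le _ _ _ _ _ _ _ (@rhs_euler_path_cvg_joint t b i) _ e0.
case=> -[P Q] /= [UP Qt] PQ.
have [d d0 dQ] : exists2 d, 0 < d & forall s, `|t - s| < d -> Q s.
  by move/nbhs_ballP : Qt => [d /= d0 dQ]; exists d => // s sd; exact: dQ.
(* Half of [d] leaves room for one step before the interval; the bound by [t] keeps all endpoints
   nonnegative. *)
exists (Num.min (d / 2) t); first by rewrite lt_min divr_gt0.
(* Pass to the limit in [euler_path_increment]: the terms with [h N] disappear. Ordered endpoints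
   let the claim serve both sides of [t]. *)
have claim r1 r2 : 0 <= r1 <= r2 -> t - d / 2 < r1 -> r2 < t + d / 2 ->
    `|c b i r2 - c b i r1 - (r2 - r1) * v| <= e * (r2 - r1).
  move=> hr tr1 r2t; rewrite -subr_ge0.
  have hl : e * (r2 - r1 + h N) + `|v| * h N - `|A N r2 b i - A N r1 b i - (r2 - r1) * v|
      @[N --> U] --> e * (r2 - r1 + 0) + `|v| * 0 - `|c b i r2 - c b i r1 - (r2 - r1) * v|.
    apply: cvgB.
      apply: cvgD; apply: cvgM; try exact: cvg_cst; last exact: stepU_cvg0.
      by apply: cvgD; [exact: cvg_cst|exact: stepU_cvg0].
    apply: cvg_norm; apply: cvgB; last exact: cvg_cst.
    by apply: cvgB; exact: euler_path_cvg.
  rewrite mulr0 !addr0 in hl; apply: (cvgr_to_ge hl).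
  have d20 : 0 < d / 2 by rewrite divr_gt0.
  have hsmall := @cvgr_dist_le _ _ _ _ _ _ _ stepU_cvg0 _ d20.
  near=> N.
  have hN : `|0 - h N| <= d / 2 by near: N; exact: hsmall.
  have PN : P N by near: N; exact: UP.
  rewrite subr_ge0; apply: euler_path_increment => //; first exact: ltW.
  move=> s /andP[s1 s2]; apply: (PQ (N, s)); split => //=.
  rewrite sub0r normrN gtr0_norm ?(euler_step_gt0 C0 hc0)// in hN.
  by apply: dQ; rewrite ltr_norml; apply/andP; split; lra.
move=> s; rewrite lt_min => /andP[sd st].
move: sd st; rewrite !ltr_norml => /andP[? ?] /andP[? ?].
have [ts|st] := leP t s.
  rewrite [`|s - t|]ger0_norm ?subr_ge0//; apply: claim; [apply/andP; split; lra|lra|lra].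
rewrite [`|s - t|]distrC [`|t - s|]ger0_norm ?subr_ge0 ?(ltW st)// -normrN.
rewrite (_ : - (c b i s - c b i t - (s - t) * v) = c b i t - c b i s - (t - s) * v); last by ring.
by apply: claim; [apply/andP; split; lra|lra|lra].
Unshelve. all: by end_near. Qed.

End Existence.

Lemma coag_annih_ode_exists (R : realType) (M C : R) (K J : nat -> nat -> R)
    (c0 : bool -> nat -> R) : 0 <= C -> bounded_kernel C K -> bounded_kernel C J ->
  (forall b, nonneg_mass M (c0 b)) -> exists c, coag_annih_ode M K J c0 c.
Proof.
move=> C0 hK hJ hc0.
have [U [UU hU]] := @ultraFilterLemma nat \oo _.
exists (ultralimit M C K J c0 U); split.
- by move=> b t; exact: (ultralimit_nonneg_mass C0 hK hJ hc0 UU b t).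
- by move=> b i t t0; apply: ultralimit_nonpos.
- by move=> b i; exact: (ultralimit_continuous C0 hK hJ hc0 UU hU (i:=i)).
- by move=> b i t; exact: (ultralimit_is_derive C0 hK hJ hc0 UU hU b i).
Qed.

(** * Stability and uniqueness *)

Section Stability.
Variable R : realType.

Lemma sum_ord_indicator n m (F : nat -> R) : (n <= m)%N ->
  \sum_(i < m) (if (i < n)%N then F i else 0) = \sum_(i < n) F i.
Proof. by move=> nm; rewrite -big_mkcond/= (big_ord_widen m F nm). Qed.

(** Only the loss series are cut at [m], so all sums can be rearranged before [m] tends to
    infinity. *)
Definition truncated_rhs m (K J : nat -> nat -> R) (x y : nat -> R) i : R :=
  2^-1 * (\sum_(j < i.+1) K j (i - j)%N * (x j * x (i - j)%N))
  - x i * (\sum_(j < m) K i j * x j + \sum_(j < m) J i j * y j).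

Lemma truncated_rhs_cvg M C (K J : nat -> nat -> R) (x y : nat -> R) i :
  0 <= C -> bounded_kernel C K -> bounded_kernel C J -> nonneg_mass M x -> nonneg_mass M y ->
  truncated_rhs m K J x y i @[m --> \oo] --> rhs K J x y i.
Proof.
move=> C0 hK hJ hx hy.
have Ci0 : 0 <= C * rootn R i by rewrite mulr_ge0 ?rootn_ge0.
apply: cvgB; first exact: cvg_cst.
apply: cvgM; first exact: cvg_cst.
apply: cvgD.
  exact: (rate_cvg hx Ci0 (kernel_row i hK)).
exact: (rate_cvg hy Ci0 (kernel_row i hJ)).
Qed.

Variables (M C : R) (K J : nat -> nat -> R) (x y x' y' : nat -> R).
Hypotheses (C0 : 0 <= C) (hK : bounded_kernel C K) (hJ : bounded_kernel C J).
Hypotheses (hx : nonneg_mass M x) (hy : nonneg_mass M y).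
Hypotheses (hx' : nonneg_mass M x') (hy' : nonneg_mass M y').
(** [theta] is an approximate sign of [x - x'] with defect [eta]; [W] controls the weighted distance
    for both species. *)
Variables (theta : nat -> R) (eta W : R) (n : nat).
Hypotheses (theta1 : forall i, `|theta i| <= 1) (eta0 : 0 <= eta).
Hypothesis theta_sign : forall i, `|x i - x' i| - eta <= theta i * (x i - x' i).
Hypothesis hWx : forall m, \sum_(k < m) rootn R k * `|x k - x' k| <= W.
Hypothesis hWy : forall m, \sum_(k < m) rootn R k * `|y k - y' k| <= W.

(** The test sequence, cut off at [n]; [err] below is the price of smoothing the sign. *)
Let phi i : R := if (i < n)%N then rootn R i * theta i else 0.
Let err i : R := if (i < n)%N then rootn R i * eta else 0.

Let M0 : 0 <= M. Proof. exact: (nonneg_mass_M_ge0 hx). Qed.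

Let phi_norm i : `|phi i| <= rootn R i.
Proof.
rewrite /phi; case: ifP => _; last by rewrite normr0 rootn_ge0.
by rewrite normrM ger0_norm ?rootn_ge0// ler_piMr ?rootn_ge0.
Qed.

Let phi_mul i z : - phi i * z <= rootn R i * `|z|.
Proof.
rewrite (le_trans (ler_norm _))// normrM normrN ler_wpM2r//.
Qed.

Let err_ge0 i : 0 <= err i.
Proof. by rewrite /err; case: ifP => // _; rewrite mulr_ge0 ?rootn_ge0. Qed.

Let phi_self i : - phi i * (x i - x' i) <= err i.
Proof.
rewrite /phi /err; case: ifP => _; last by rewrite oppr0 mul0r.
rewrite mulNr -mulrA -mulrN ler_wpM2l ?rootn_ge0// lerNl.
by apply: le_trans (theta_sign i); rewrite lerBrDl subrr.
Qed.

Let sum_err m : (n <= m)%N -> \sum_(k < m) rootn R k * err k <= n%:R * n%:R * eta.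
Proof.
move=> nm.
rewrite (eq_bigr (fun k : 'I_m => if (k < n)%N then k%:R * eta else 0)); last first.
  by move=> k _; rewrite /err; case: ifP; rewrite ?mulr0// mulrA rootnM.
rewrite (sum_ord_indicator (fun k => k%:R * eta) nm) -mulr_suml ler_wpM2r//.
rewrite -[X in X%:R * _](card_ord n) mulr_natl -sumr_const.
by apply: ler_sum => i _; rewrite ler_nat ltnW.
Qed.

(** Let [u k = x k - x' k]. For [k < n], subadditivity of the root bounds the first term by
    [(rootn j + rootn k) |u k|], and the favourable sign of [- phi k * u k] cancels [rootn k |u k|]
    up to [err k]. For [k >= n] both [phi (j + k)] and [phi k] vanish. The remaining [rootn j]
    combines with the one in the kernel bound to [j], the weight of the mass. *)
Let coag_pair j k :
  K j k * (phi (j + k)%N - phi j - phi k) * ((x j + x' j) * (x k - x' k)) <=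
  C * (2 * ((j%:R * (x j + x' j)) * (rootn R k * `|x k - x' k|)) +
       (rootn R j * (x j + x' j)) * (rootn R k * err k)).
Proof.
pose u k := x k - x' k; rewrite -/(u k).
have p0 : 0 <= x j + x' j by rewrite addr_ge0 ?(nonneg_mass_ge0 hx) ?(nonneg_mass_ge0 hx').
have [K0 _ KC] := hK j k.
have qj := rootn_ge0 R j; have qk := rootn_ge0 R k.
have main : (phi (j + k)%N - phi j - phi k) * u k <= 2 * rootn R j * `|u k| + err k.
  have h1 := phi_mul j (u k).
  have [kn|nk] := ltnP k n.
    have h2 : phi (j + k)%N * u k <= (rootn R j + rootn R k) * `|u k|.
      rewrite (le_trans (ler_norm _))// normrM ler_wpM2r//.
      exact: le_trans (phi_norm _) (rootnD R j k).
    have h3 : - phi k * u k <= err k - rootn R k * `|u k|.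
      rewrite /phi /err kn mulNr -mulrA -mulrBr -mulrN ler_wpM2l// lerNl opprB.
      exact: theta_sign.
    lra.
  have -> : phi (j + k)%N = 0 by rewrite /phi ltnNge (leq_trans nk) ?leq_addl.
  have -> : phi k = 0 by rewrite /phi ltnNge nk.
  have := err_ge0 k; have : 0 <= rootn R j * `|u k| by rewrite mulr_ge0.
  lra.
rewrite [leLHS](_ : _ = (K j k * (x j + x' j)) * ((phi (j + k)%N - phi j - phi k) * u k)); last by ring.
apply: (le_trans (ler_wpM2l _ main)); first by rewrite mulr_ge0.
have m0 : 0 <= 2 * rootn R j * `|u k| + err k.
  by rewrite addr_ge0 ?err_ge0// !mulr_ge0.
apply: (@le_trans _ _ (C * (rootn R j * rootn R k) * (x j + x' j) * (2 * rootn R j * `|u k| + err k))).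
  by rewrite ler_wpM2r// ler_wpM2r.
by rewrite -[in leRHS](rootnM R j) le_eqVlt; apply/orP; left; apply/eqP; ring.
Qed.

(** Split [x y - x' y' = (x - x') y + x' (y - y')]. The first part has a favourable sign up to
    [err]; in the second, the root in [phi j] and the one in the kernel bound combine to the weight
    [j] on [x']. *)
Let annih_pair j k :
  - phi j * (J j k * (x j * y k - x' j * y' k)) <=
  C * ((rootn R j * err j) * (rootn R k * y k) +
       (j%:R * x' j) * (rootn R k * `|y k - y' k|)).
Proof.
have [J0 _ JC] := hJ j k.
have yk0 := nonneg_mass_ge0 hy k; have xj0 := nonneg_mass_ge0 hx' j.
have qj := rootn_ge0 R j; have qk := rootn_ge0 R k.
rewrite [leLHS](_ : _ = J j k * (- phi j * (x j - x' j) * y k + x' j * (- phi j * (y k - y' k)))); last by ring.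
apply: (@le_trans _ _ (J j k * (err j * y k + x' j * (rootn R j * `|y k - y' k|)))).
  by rewrite ler_wpM2l// lerD// ?ler_wpM2r// ler_wpM2l.
apply: (@le_trans _ _ (C * (rootn R j * rootn R k) * (err j * y k + x' j * (rootn R j * `|y k - y' k|)))).
  by rewrite ler_wpM2r// addr_ge0 ?mulr_ge0 ?err_ge0.
by rewrite -[in leRHS](rootnM R j) le_eqVlt; apply/orP; left; apply/eqP; ring.
Qed.

(** The gain is reindexed by [sum_convolution] and everything is symmetrised in [j, k]. The
    symmetric kernel then allows replacing [x j * x k - x' j * x' k] by
    [(x j + x' j) * (x k - x' k)], since the former is the average of the latter and its
    transpose. *)
Let weak_form m : (n <= m)%N ->
  \sum_(i < n) rootn R i * theta i * (truncated_rhs m K J x y i - truncated_rhs m K J x' y' i) =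
  2^-1 * (\sum_(j < m) \sum_(k < m)
     K j k * (phi (j + k)%N - phi j - phi k) * ((x j + x' j) * (x k - x' k)))
  + \sum_(j < m) \sum_(k < m) - phi j * (J j k * (x j * y k - x' j * y' k)).
Proof.
move=> nm.
rewrite -(sum_ord_indicator (fun i => rootn R i * theta i *
  (truncated_rhs m K J x y i - truncated_rhs m K J x' y' i)) nm).
pose D j k := K j k * (x j * x k - x' j * x' k).
transitivity (\sum_(i < m) (2^-1 * (phi i * \sum_(j < i.+1) D j (i - j)%N)
    - \sum_(k < m) phi i * D i k + \sum_(k < m) - phi i * (J i k * (x i * y k - x' i * y' k)))).
  apply: eq_bigr => i _.
  have -> : (if (i < n)%N then rootn R i * theta i *
    (truncated_rhs m K J x y i - truncated_rhs m K J x' y' i) else 0) =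
    phi i * (truncated_rhs m K J x y i - truncated_rhs m K J x' y' i).
    by rewrite /phi; case: ifP; rewrite ?mul0r.
  rewrite /truncated_rhs /D -!mulr_sumr.
  have -> : \sum_(j < i.+1) K j (i - j)%N * (x j * x (i - j)%N - x' j * x' (i - j)%N) =
    \sum_(j < i.+1) K j (i - j)%N * (x j * x (i - j)%N) -
    \sum_(j < i.+1) K j (i - j)%N * (x' j * x' (i - j)%N).
    by rewrite -sumrB; apply: eq_bigr => j _; rewrite mulrBr.
  have -> : \sum_(k < m) K i k * (x i * x k - x' i * x' k) =
    x i * \sum_(k < m) K i k * x k - x' i * \sum_(k < m) K i k * x' k.
    by rewrite !mulr_sumr -sumrB; apply: eq_bigr => j _; ring.
  have -> : \sum_(k < m) J i k * (x i * y k - x' i * y' k) =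
    x i * \sum_(k < m) J i k * y k - x' i * \sum_(k < m) J i k * y' k.
    by rewrite !mulr_sumr -sumrB; apply: eq_bigr => j _; ring.
  ring.
rewrite big_split/= sumrB -mulr_sumr (@sum_convolution _ m D phi); last first.
  by move=> i mi; rewrite /phi ltnNge (leq_trans nm mi).
congr (_ + _).
rewrite (sum_swap m (fun j k => phi j * D j k)) -mulrBr; congr (_ * _).
rewrite [RHS](sum_swap m (fun j k =>
  K j k * (phi (j + k)%N - phi j - phi k) * ((x j + x' j) * (x k - x' k)))).
rewrite -sumrB mulr_sumr; apply: eq_bigr => j _.
rewrite -sumrB mulr_sumr; apply: eq_bigr => k _.
have [_ Ks _] := hK j k.
by rewrite /D -Ks [(k + j)%N]addnC; field.
Qed.

(** As [x + x'] has mass at most [2 M], coagulation contributes [2 C M W] after the factor 1/2, and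
    annihilation [C M W]. Each also contributes [C M] times the total smoothing error [n^2 eta]. *)
Lemma rhs_stability :
  \sum_(i < n) rootn R i * theta i * (rhs K J x y i - rhs K J x' y' i) <=
  3 * (C * M * W) + 2 * (C * M * (n%:R * n%:R * eta)).
Proof.
have hl : \sum_(i < n) rootn R i * theta i *
    (truncated_rhs m K J x y i - truncated_rhs m K J x' y' i) @[m --> \oo] -->
   \sum_(i < n) rootn R i * theta i * (rhs K J x y i - rhs K J x' y' i).
  apply: cvg_big => // [|i _]; first by move=> z; exact: add_continuous.
  apply: cvgM; first exact: cvg_cst.
  by apply: cvgB; apply: (@truncated_rhs_cvg M C).
apply: (cvgr_to_le hl); near=> m.
have nm : (n <= m)%N by near: m; exact: nbhs_infty_ge.
rewrite weak_form//.
pose P := \sum_(j < m) j%:R * (x j + x' j).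
have hP : 0 <= P <= 2 * M.
  rewrite /P; under eq_bigr do rewrite mulrDr.
  rewrite big_split/= addr_ge0 ?sumr_ge0//=; last 2 first.
  - by move=> j _; rewrite mulr_ge0 ?(nonneg_mass_ge0 hx).
  - by move=> j _; rewrite mulr_ge0 ?(nonneg_mass_ge0 hx').
  by have := hx.2 m; have := hx'.2 m; lra.
have hP' : 0 <= \sum_(j < m) rootn R j * (x j + x' j) <= 2 * M.
  under eq_bigr do rewrite mulrDr.
  rewrite big_split/= addr_ge0 ?sumr_ge0//=; last 2 first.
  - by move=> j _; rewrite mulr_ge0 ?rootn_ge0 ?(nonneg_mass_ge0 hx).
  - by move=> j _; rewrite mulr_ge0 ?rootn_ge0 ?(nonneg_mass_ge0 hx').
  by have := rootn_sum_le hx m; have := rootn_sum_le hx' m; lra.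
set N2 := n%:R * n%:R * eta.
have N0 : 0 <= N2 by rewrite !mulr_ge0.
have sum_prod (a b : nat -> R) A B : (forall j, 0 <= a j) -> (forall j, 0 <= b j) ->
    \sum_(j < m) a j <= A -> \sum_(j < m) b j <= B ->
    \sum_(j < m) \sum_(k < m) a j * b k <= A * B.
  move=> a0 b0 aA bB; rewrite -big_distrlr/=.
  by apply: ler_pM => //; apply: sumr_ge0.
have xx0 j : 0 <= x j + x' j by rewrite addr_ge0 ?(nonneg_mass_ge0 hx) ?(nonneg_mass_ge0 hx').
have c1 : \sum_(j < m) \sum_(k < m) K j k * (phi (j + k)%N - phi j - phi k) *
    ((x j + x' j) * (x k - x' k)) <= C * (2 * (2 * M * W) + 2 * M * N2).
  apply: (@le_trans _ _ (\sum_(j < m) \sum_(k < m)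
    C * (2 * ((j%:R * (x j + x' j)) * (rootn R k * `|x k - x' k|)) +
       (rootn R j * (x j + x' j)) * (rootn R k * err k)))).
    by apply: ler_sum => j _; apply: ler_sum => k _; exact: coag_pair.
  under eq_bigr do rewrite -mulr_sumr big_split/= -mulr_sumr.
  rewrite -mulr_sumr big_split/= -mulr_sumr ler_wpM2l// lerD// ?ler_wpM2l//.
    apply: (sum_prod (fun j => j%:R * (x j + x' j)) (fun k => rootn R k * `|x k - x' k|)) => //.
    - by move=> j; rewrite mulr_ge0.
    - by move=> j; rewrite mulr_ge0 ?rootn_ge0.
    - by case/andP : hP.
  apply: (sum_prod (fun j => rootn R j * (x j + x' j)) (fun k => rootn R k * err k)) => //.
  - by move=> j; rewrite mulr_ge0 ?rootn_ge0.
  - by move=> j; rewrite mulr_ge0 ?rootn_ge0.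
  - by case/andP : hP'.
  - exact: sum_err.
have c2 : \sum_(j < m) \sum_(k < m) - phi j * (J j k * (x j * y k - x' j * y' k)) <=
    C * (N2 * M + M * W).
  apply: (@le_trans _ _ (\sum_(j < m) \sum_(k < m)
    C * ((rootn R j * err j) * (rootn R k * y k) +
       (j%:R * x' j) * (rootn R k * `|y k - y' k|)))).
    by apply: ler_sum => j _; apply: ler_sum => k _; exact: annih_pair.
  under eq_bigr do rewrite -mulr_sumr big_split/=.
  rewrite -mulr_sumr big_split/= ler_wpM2l// lerD//.
    apply: (sum_prod (fun j => rootn R j * err j) (fun k => rootn R k * y k)) => //.
    - by move=> j; rewrite mulr_ge0 ?rootn_ge0.
    - by move=> j; rewrite mulr_ge0 ?rootn_ge0 ?(nonneg_mass_ge0 hy).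
    - exact: sum_err.
    - exact: rootn_sum_le.
  apply: (sum_prod (fun j => j%:R * x' j) (fun k => rootn R k * `|y k - y' k|)) => //.
  - by move=> j; rewrite mulr_ge0 ?(nonneg_mass_ge0 hx').
  - by move=> j; rewrite mulr_ge0 ?rootn_ge0.
  - exact: hx'.2.
lra.
Unshelve. all: by end_near. Qed.

End Stability.

(** * Smoothed absolute values and the Gronwall argument *)

Section Gronwall.
Variable R : realType.

(** A differentiable substitute for the absolute value; its slope [z / softabs e z] is the smoothed
    sign used as [theta]. *)
Definition softabs (e z : R) : R := Num.sqrt (z ^+ 2 + e ^+ 2).

Lemma softabs_gt0 e z : 0 < e -> 0 < softabs e z.
Proof. by move=> e0; rewrite sqrtr_gt0 ltr_wpDl ?sqr_ge0 ?exprn_gt0. Qed.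

Lemma sqr_softabs e z : softabs e z ^+ 2 = z ^+ 2 + e ^+ 2.
Proof. by rewrite sqr_sqrtr// addr_ge0 ?sqr_ge0. Qed.

Lemma softabs_ge e z : `|z| <= softabs e z.
Proof. by rewrite -sqrtr_sqr ler_wsqrtr// lerDl sqr_ge0. Qed.

Lemma softabs0 e : 0 <= e -> softabs e 0 = e.
Proof. by move=> e0; rewrite /softabs expr0n add0r sqrtr_sqr ger0_norm. Qed.

Lemma softabs_slope_le1 e z : 0 < e -> `|z / softabs e z| <= 1.
Proof.
move=> e0; have s0 := softabs_gt0 z e0.
by rewrite normrM normfV (gtr0_norm s0) ler_pdivrMr// mul1r softabs_ge.
Qed.

(** With [s = softabs e z], [z^2 / s = (s - e) (s + e) / s >= s - e >= |z| - e]. *)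
Lemma softabs_slope_sign e z : 0 < e -> `|z| - e <= z / softabs e z * z.
Proof.
move=> e0; have s0 := softabs_gt0 z e0; have zs := softabs_ge e z.
have se : e <= softabs e z.
  by rewrite -[leLHS]ger0_norm ?(ltW e0)// -sqrtr_sqr ler_wsqrtr// lerDr sqr_ge0.
rewrite mulrAC -expr2 ler_pdivlMr//.
have -> : z ^+ 2 = softabs e z ^+ 2 - e ^+ 2 by rewrite sqr_softabs addrK.
nra.
Qed.

Lemma is_derive_softabs (e : R) (u : R -> R) (t du : R) : 0 < e -> is_derive t 1 u du ->
  is_derive t 1 (fun s => softabs e (u s)) (u t / softabs e (u t) * du).
Proof.
move=> e0 hu.
have s0 : 0 < u t ^+ 2 + e ^+ 2 by rewrite ltr_wpDl ?sqr_ge0 ?exprn_gt0.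
have h1 : is_derive t 1 (fun s => u s ^+ 2 + e ^+ 2) (2 * u t * du).
  have -> : (fun s => u s ^+ 2 + e ^+ 2) = u ^+ 2 + cst (e ^+ 2).
    by apply/funext => s; rewrite [RHS]/GRing.add/= exprfctE.
  apply: is_derive_eq.
  by rewrite addr0 expr1.
have h2 := is_derive1_sqrt s0.
have h3 := @is_derive1_comp R Num.sqrt (fun s => u s ^+ 2 + e ^+ 2) t _ _ h2 h1.
suff -> : u t / softabs e (u t) * du = (2 * Num.sqrt (u t ^+ 2 + e ^+ 2))^-1 * (2 * u t * du).
  by exact: h3.
rewrite -/(softabs e (u t)); have := softabs_gt0 (u t) e0 => sn0.
by field; rewrite gt_eqF.
Qed.

Lemma is_derive_scale (a t : R) : is_derive t 1 (fun s => a * s) a.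
Proof.
rewrite -[X in is_derive _ _ _ X]mulr1.
by apply: is_deriveZ; exact: is_derive_id.
Qed.

Lemma nonincreasing_of_derive (f df : R -> R) (t : R) : 0 <= t -> continuous f ->
  (forall s : R, 0 < s -> is_derive s 1 f (df s)) -> (forall s, 0 < s -> df s <= 0) -> f t <= f 0.
Proof.
rewrite le_eqVlt => /orP[/eqP <- //|t0] cf hf df0.
have [|s|s] := @MVT R f df 0 t t0.
- by move=> s; rewrite in_itv/= => /andP[s0 _]; exact: hf.
- exact: continuous_subspaceT.
rewrite in_itv/= => /andP[s0 _] hs.
by rewrite -subr_le0 hs mulr_le0_ge0 ?df0// subr0 ltW.
Qed.

Variables (M C : R) (K J : nat -> nat -> R) (c0 : bool -> nat -> R).
Hypotheses (C0 : 0 <= C) (hK : bounded_kernel C K) (hJ : bounded_kernel C J).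
Variables c c' : bool -> nat -> R -> R.
Hypotheses (hc : coag_annih_ode M K J c0 c) (hc' : coag_annih_ode M K J c0 c').

Let M0 : 0 <= M. Proof. by case: hc => /(_ true 0)/nonneg_mass_M_ge0. Qed.

(** More than twice the factor [3 C M] of [rhs_stability]: the derivative of
    [S / 2 * expR (lam * s)] then dominates [3 C M S expR (lam * s)]. *)
Let lam : R := 6 * (C * M) + 1.

(** The assumed bound serves as [W] in [rhs_stability], which bounds the derivative of each finite
    smoothed sum. The choice of [lam] makes half the bound grow faster than that sum, and the
    smoothing parameter is sent to 0. Only finite sums are differentiated. *)
Lemma difference_halving S :
  (forall b m s, 0 <= s -> \sum_(k < m) rootn R k * `|c b k s - c' b k s| <= S * expR (lam * s)) ->
  (forall b m s, 0 <= s -> \sum_(k < m) rootn R k * `|c b k s - c' b k s| <= S / 2 * expR (lam * s)).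
Proof.
move=> hS b n t t0.
have [hm hinit hcont hder] := hc; have [hm' hinit' hcont' hder'] := hc'.
have S0 : 0 <= S.
  by have := hS true 0%N 0 (lexx 0); rewrite big_ord0 mulr0 expR0 mulr1.
(* The cost of smoothing per unit of [e]: the initial value [F 0] plus the drift [G] over time
   [t]. *)
pose B := n%:R * n%:R + 2 * (C * M * (n%:R * n%:R)) * t.
have B0 : 0 <= B by rewrite addr_ge0 ?mulr_ge0.
apply/ler_addgt0Pr => e1 e10.
pose e := e1 / (B + 1).
have B1 : 0 < B + 1 by rewrite ltr_wpDl.
have e0 : 0 < e by rewrite divr_gt0.
have eB : e * B <= e1.
  by rewrite /e mulrAC ler_pdivrMr// ler_wpM2l ?(ltW e10)// lerDl.
pose u k s := c b k s - c' b k s.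
pose F s := \sum_(k < n) rootn R k * softabs e (u k s).
pose G := 2 * (C * M * (n%:R * n%:R * e)).
(* [H] is nonincreasing, and [H 0 <= F 0] because [S >= 0]. *)
pose H s := F s - S / 2 * expR (lam * s) - G * s.
pose dF s := \sum_(k < n) rootn R k * (u k s / softabs e (u k s) *
  (rhs K J (fun j => c b j s) (fun j => c (~~ b) j s) k -
   rhs K J (fun j => c' b j s) (fun j => c' (~~ b) j s) k)).
have Fder (s : R) : 0 < s -> is_derive s 1 F (dF s).
  move=> s0.
  have -> : F = \sum_(k < n) (fun s => rootn R k * softabs e (u k s)).
    by apply/funext => z; rewrite fct_sumE.
  apply: is_derive_sum => k; apply: is_deriveZ; apply: is_derive_softabs => //.
  by apply: is_deriveB; [exact: hder|exact: hder'].
have Hder (s : R) : 0 < s -> is_derive s 1 H (dF s - S / 2 * (expR (lam * s) * lam) - G).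
  move=> s0; apply: is_deriveB.
    apply: is_deriveB; first exact: Fder.
    apply: is_deriveZ; apply: (is_derive1_comp (is_derive_expR _)).
    exact: is_derive_scale.
  exact: is_derive_scale.
have Hcont : continuous H.
  move=> s; apply: cvgB; last by apply: cvgM; [exact: cvg_cst|exact: cvg_id].
  apply: cvgB.
    apply: cvg_big => // [|k _]; first by move=> z; exact: add_continuous.
    apply: cvgM; first exact: cvg_cst.
    apply: (@continuous_comp _ _ _ (fun z => u k z ^+ 2 + e ^+ 2) Num.sqrt); last exact: sqrt_continuous.
    apply: cvgD; last exact: cvg_cst.
    by apply: cvgM; apply: cvgB; [exact: hcont|exact: hcont'|exact: hcont|exact: hcont'].
  apply: cvgM; first exact: cvg_cst.
  apply: continuous_comp; last exact: continuous_expR.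
  by apply: cvgM; [exact: cvg_cst|exact: cvg_id].
have Hneg (s : R) : 0 < s -> dF s - S / 2 * (expR (lam * s) * lam) - G <= 0.
  move=> s0.
  have := @rhs_stability R M C K J (fun j => c b j s) (fun j => c (~~ b) j s)
    (fun j => c' b j s) (fun j => c' (~~ b) j s) C0 hK hJ (hm b s) (hm (~~ b) s)
    (hm' b s) (hm' (~~ b) s) (fun k => u k s / softabs e (u k s)) e (S * expR (lam * s)) n
    (fun k => softabs_slope_le1 _ e0) (ltW e0) (fun k => softabs_slope_sign _ e0)
    (fun m => hS b m s (ltW s0)) (fun m => hS (~~ b) m s (ltW s0)).
  under eq_bigr do rewrite -mulrA.
  rewrite -/(dF s) -/G /lam.
  have : 0 <= S * expR ((6 * (C * M) + 1) * s) by rewrite mulr_ge0 ?expR_ge0.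
  move: (expR _) => E; nra.
have Hle := nonincreasing_of_derive t0 Hcont Hder Hneg.
have F0 : F 0 <= n%:R * n%:R * e.
  rewrite /F; under eq_bigr => k _.
    rewrite /u hinit// hinit'// subrr softabs0 ?(ltW e0)//; over.
  rewrite -mulr_suml ler_wpM2r ?(ltW e0)// -[X in X%:R * _](card_ord n) mulr_natl -sumr_const.
  apply: ler_sum => k _; rewrite (le_trans (rootn_le _ _))// ler_nat ltnW//.
have Ft : \sum_(k < n) rootn R k * `|c b k t - c' b k t| <= F t.
  by apply: ler_sum => k _; rewrite ler_wpM2l ?rootn_ge0// softabs_ge.
move: Hle; rewrite /H !mulr0 expR0 subr0 => Hle.
have GB : n%:R * n%:R * e + G * t = e * B by rewrite /G /B; ring.
lra.
Qed.

(** The masses give the initial bound [2 M]; repeated halving drives it to 0. *)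
Lemma coag_annih_ode_unique b i t : (0 < i)%N -> 0 <= t -> c b i t = c' b i t.
Proof.
move=> i0 t0.
have [hm _ _ _] := hc; have [hm' _ _ _] := hc'.
have hS (n : nat) : forall b m s, 0 <= s ->
    \sum_(k < m) rootn R k * `|c b k s - c' b k s| <= (2 * M) / 2 ^+ n * expR (lam * s).
  elim: n => [|n IH].
    move=> b' m s s0; rewrite expr0 divr1.
    apply: (@le_trans _ _ (2 * M)); last first.
      rewrite ler_peMr ?mulr_ge0// -expR0 ler_expR mulr_ge0//.
      by rewrite /lam addr_ge0 ?mulr_ge0.
    apply: (@le_trans _ _ (\sum_(k < m) (rootn R k * c b' k s + rootn R k * c' b' k s))).
      apply: ler_sum => k _; rewrite -mulrDr ler_wpM2l ?rootn_ge0//.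
      rewrite (le_trans (ler_normB _ _))// !ger0_norm//.
        exact: (nonneg_mass_ge0 (hm' b' s)).
      exact: (nonneg_mass_ge0 (hm b' s)).
    rewrite big_split/=; have := rootn_sum_le (hm b' s) m.
    have := rootn_sum_le (hm' b' s) m; lra.
  move=> b' m s s0; have := difference_halving IH b' m s0.
  by rewrite exprSr invfM mulrA.
have hi n : rootn R i * `|c b i t - c' b i t| <= 2 * M * expR (lam * t) * (2^-1) ^+ n.
  have := hS n b i.+1 t t0; rewrite big_ord_recr/= exprVn mulrAC; apply: le_trans.
  by rewrite lerDr sumr_ge0// => k _; rewrite mulr_ge0 ?rootn_ge0.
have : rootn R i * `|c b i t - c' b i t| <= 0.
  have hl : 2 * M * expR (lam * t) * 2^-1 ^+ n @[n --> \oo] --> 2 * M * expR (lam * t) * 0.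
    apply: cvgM; first exact: cvg_cst.
    by apply: cvg_expr; rewrite ger0_norm// invf_lt1// ltr1n.
  by rewrite mulr0 in hl; apply: (cvgr_to_ge hl); apply: nearW.
rewrite pmulr_rle0 ?rootn_gt0// normr_le0 subr_eq0 => /eqP.
by [].
Qed.

End Gronwall.

(** * Solutions of the integral equations *)

Section ZeroExtension.
Variable R : realType.
Implicit Types (x : nat -> R) (K J : nat -> nat -> R) (c d : nat -> R -> R).

(* The index [0] carries no information in the statement; with rates vanishing
   there, sums over [i >= 1] become sums over all indices. *)
Definition zero_ext (x : nat -> R) i : R := if i is 0 then 0 else x i.
Definition zero_ext2 (K : nat -> nat -> R) i j : R := if i is 0 then 0 else zero_ext (K i) j.

Lemma sum_zero_ext n x : \sum_(j < n) zero_ext x j = \sum_(1 <= j < n) x j.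
Proof.
case: n => [|n]; first by rewrite big_ord0 big_geq.
by rewrite big_ord_recl/= add0r big_add1 big_mkord.
Qed.

Lemma eseries_zero_ext x l :
  (fun n => \sum_(j < n) zero_ext x j) @ \oo --> l -> (\sum_(1 <= j <oo) (x j)%:E)%E = l%:E.
Proof.
move=> hl; apply: cvg_lim => //.
under eq_fun do rewrite sumEFin -sum_zero_ext.
by apply: cvg_EFin => //; exact: nearW.
Qed.

Lemma bounded_zero_ext2 C K : 0 <= C ->
  (forall i j, (1 <= i)%N -> (1 <= j)%N ->
     [/\ 0 <= K i j, K i j = K j i & K i j <= C * (rootn R i * rootn R j)]) ->
  bounded_kernel C (zero_ext2 K).
Proof.
move=> C0 hK [|i] [|j] /=; rewrite ?rootn0 ?mul0r ?mulr0; split => //.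
all: by have [] := hK i.+1 j.+1 isT isT.
Qed.

(** Agreement from index 1 on suffices since [zero_ext2 K] vanishes at 0; thus [x] may be a solution
    of the differential system or a zero extension. *)
Lemma rate_sum_eq C M K c i s x : 0 <= C -> bounded_kernel C (zero_ext2 K) -> nonneg_mass M x ->
  (forall j, (1 <= j)%N -> x j = c j s) -> (1 <= i)%N ->
  rate_sum K c i s = (rate (zero_ext2 K i) x)%:E.
Proof.
move=> C0 hK hx xc i1; apply: eseries_zero_ext.
have Ci0 : 0 <= C * rootn R i by rewrite mulr_ge0 ?rootn_ge0.
rewrite (_ : (fun n => _) = fun n => \sum_(j < n) zero_ext2 K i j * x j).
  exact: (rate_cvg hx Ci0 (kernel_row i hK)).
apply/funext => n; apply: eq_bigr => -[[|j] jn] _ /=.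
  by case: i i1 {Ci0} => //= i _; rewrite mul0r.
by case: i i1 {Ci0} => //= i _; rewrite xc.
Qed.

Lemma coag_annih_rhs_eq C M K J c d i s x y :
  0 <= C -> bounded_kernel C (zero_ext2 K) -> bounded_kernel C (zero_ext2 J) ->
  nonneg_mass M x -> nonneg_mass M y ->
  (forall j, (1 <= j)%N -> x j = c j s) -> (forall j, (1 <= j)%N -> y j = d j s) -> (1 <= i)%N ->
  coag_annih_rhs K J c d i s = (rhs (zero_ext2 K) (zero_ext2 J) x y i)%:E.
Proof.
move=> C0 hK hJ hx hy xc yd i1; rewrite /coag_annih_rhs.
rewrite (rate_sum_eq C0 hK hx xc i1) (rate_sum_eq C0 hJ hy yd i1) -!EFinM -!EFinB.
congr (_%:E); rewrite /rhs mulrDr opprD addrA xc//; congr (_ * _ - _ - _).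
(* The end terms [j = i] and [j = 0] vanish, leaving the range [1 <= j < i] of the statement. *)
rewrite -sum_zero_ext big_ord_recr/= subnn.
have -> : zero_ext2 K i 0 = 0 by case: i i1.
rewrite mul0r addr0; apply: eq_bigr => -[[|j] ji] _ /=; first by rewrite mul0r.
have : (0 < i - j.+1)%N by rewrite subn_gt0.
by case: (i - j.+1)%N => [//|k] _ /=; rewrite !xc// mulrA.
Qed.

Lemma inXpos_nonneg_mass x : inXpos 1 x -> exists M, nonneg_mass M (zero_ext x).
Proof.
move=> [hX x0]; exists (fine (Xnorm 1 x)); split=> [[|i]//=|n]; first exact: x0.
have ge0 j : (1 <= j)%N -> true -> (0 <= ((j%:R `^ 1) * `|x j|)%:E)%E.
  by move=> _ _; rewrite lee_fin mulr_ge0 ?powR_ge0.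
rewrite -lee_fin fineK; last first.
  rewrite ge0_fin_numE//; exact: nneseries_ge0.
apply: le_trans (nneseries_lim_ge n ge0).
rewrite sumEFin lee_fin -sum_zero_ext; apply: ler_sum => -[[|i] ilt] _ //=.
by rewrite powRr1// ger0_norm// x0.
Qed.

Lemma nonneg_mass_inXpos M x : nonneg_mass M x -> inXpos 1 x.
Proof.
move=> hx; split; last by move=> i _; exact: nonneg_mass_ge0 hx i.
apply: (@le_lt_trans _ _ M%:E); last exact: ltry.
apply: lime_le.
  apply: is_cvg_nneseries => j _ _; by rewrite lee_fin mulr_ge0 ?powR_ge0.
apply: nearW => n; rewrite sumEFin lee_fin -sum_zero_ext.
apply: le_trans (hx.2 n); apply: ler_sum => -[[|i] ilt] _ /=.
  by rewrite mul0r.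
by rewrite powRr1// ger0_norm// (nonneg_mass_ge0 hx).
Qed.

Lemma nonneg_mass_le M M' x : M <= M' -> nonneg_mass M x -> nonneg_mass M' x.
Proof. by move=> MM' [x0 hx]; split=> // n; exact: le_trans (hx n) MM'. Qed.

End ZeroExtension.

(** * From the differential system to the integral equations *)

Section SolutionOfODE.
Variable R : realType.
Variables (M C : R) (K J : nat -> nat -> R) (c : bool -> nat -> R -> R).
Hypotheses (C0 : 0 <= C) (hK : bounded_kernel C K) (hJ : bounded_kernel C J).
Hypothesis hc : forall b (t : R), nonneg_mass M (fun i => c b i t).
Hypothesis hcont : forall b i, continuous (c b i).

Lemma rate_continuous L b i : bounded_kernel C L ->
  continuous (fun s => rate (L i) (fun j => c b j s)).
Proof.
move=> hL s.
have M0 := nonneg_mass_M_ge0 (hc true 0).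
have Ci0 : 0 <= C * rootn R i by rewrite mulr_ge0 ?rootn_ge0.
apply: (@cvg_rate _ _ (nbhs s) _ _ _ (fun=> L i) (fun z j => c b j z) (L i) (fun j => c b j s) (C * rootn R i * M)).
- by rewrite mulr_ge0.
- by move=> j; exact: cvg_cst.
- by move=> j; exact: hcont.
- by move=> m m0 z; exact: (rate_truncation (hc b z) Ci0 (kernel_row i hL)).
- by move=> m m0; exact: (rate_truncation (hc b s) Ci0 (kernel_row i hL)).
Qed.

Lemma rhs_continuous b i :
  continuous (fun s => rhs K J (fun j => c b j s) (fun j => c (~~ b) j s) i).
Proof.
move=> s.
apply: (@cvg_rhs _ _ (nbhs s) _ M C K J (fun=> K) (fun=> J) (fun z j => c b j z)
  (fun z j => c (~~ b) j z)) => //.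
- by move=> j k; exact: cvg_cst.
- by move=> j k; exact: cvg_cst.
- by move=> j; exact: hcont.
- by move=> j; exact: hcont.
Qed.

Lemma continuous_integrable (f : R -> R) (t : R) : continuous f ->
  lebesgue_measure.-integrable `]0, t[ (EFin \o f).
Proof.
move=> cf; apply: (@integrableS _ _ R lebesgue_measure [set` `[0, t]] [set` `]0, t[] (EFin \o f)) => //.
  by apply: subset_itvW.
apply: continuous_compact_integrable; first exact: segment_compact.
exact: continuous_subspaceT.
Qed.

Lemma ode_integral b i (t : R) :
  (forall (t : R), 0 < t -> is_derive t 1 (c b i)
     (rhs K J (fun j => c b j t) (fun j => c (~~ b) j t) i)) ->
  0 < t ->
  (\int[lebesgue_measure]_(s in `]0%R, t[)
     (rhs K J (fun j => c b j s) (fun j => c (~~ b) j s) i)%:E = (c b i t)%:E - (c b i 0)%:E)%E.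
Proof.
move=> hder t0.
rewrite -(@continuous_FTC2 R (fun s => rhs K J (fun j => c b j s) (fun j => c (~~ b) j s) i)
  (c b i) 0 t t0); last 3 first.
- by apply: continuous_subspaceT; exact: rhs_continuous.
- split.
  + by move=> s; rewrite in_itv/= => /andP[s0 _]; have [] := hder s s0.
  + by apply: cvg_at_right_filter; exact: hcont.
  + by apply: cvg_at_left_filter; exact: hcont.
- move=> s; rewrite in_itv/= => /andP[s0 _]; rewrite derive1E.
  by have [_ ->] := hder s s0.
rewrite integral_itv_bndoo//.
apply: (measurable_int lebesgue_measure).
by apply: continuous_integrable; exact: rhs_continuous.
Qed.

End SolutionOfODE.

Lemma ode_is_solution (R : realType) (M C : R) (K J : nat -> nat -> R) (a0 b0 : nat -> R)
    (c : bool -> nat -> R -> R) :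
  0 <= C -> bounded_kernel C (zero_ext2 K) -> bounded_kernel C (zero_ext2 J) ->
  coag_annih_ode M (zero_ext2 K) (zero_ext2 J) (fun b => zero_ext (if b then a0 else b0)) c ->
  is_solution K J +oo a0 b0 (c true) (c false).
Proof.
move=> C0 hK hJ [hc hinit hcont hder].
have hint L b i t : bounded_kernel C (zero_ext2 L) -> (1 <= i)%N ->
    lebesgue_measure.-integrable `]0, t[ (rate_sum L (c b) i).
  move=> hL i1; rewrite (_ : rate_sum _ _ _ = EFin \o (fun s => rate (zero_ext2 L i) (fun j => c b j s))).
    by apply: continuous_integrable; exact: (rate_continuous C0 hc hcont).
  by apply/funext => s; exact: (rate_sum_eq C0 hL (hc b s)).
have heq b i t : (1 <= i)%N -> 0 < t -> (c b i t)%:E = ((if b then a0 i else b0 i)%:E +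
    \int[lebesgue_measure]_(s in `]0%R, t[) coag_annih_rhs K J (c b) (c (~~ b)) i s)%E.
  move=> i1 t0; under eq_integral => s _.
    rewrite (coag_annih_rhs_eq C0 hK hJ (hc b s) (hc (~~ b) s))//; over.
  rewrite (ode_integral C0 hK hJ hc hcont (hder b i) t0) (hinit b i 0)//.
  by case: i i1 => //= i _; case: b; rewrite -EFinB -EFinD addrC subrK.
split.
- by move=> i t _ _ _; split; exact: (nonneg_mass_ge0 (hc _ t)).
- by move=> i _; split; exact: continuous_subspaceT.
- by move=> i t i1 _ _; split; exact: hint.
- by move=> i t i1 t0 _; split; [exact: (heq true)|exact: (heq false)].
Qed.

(** * From the integral equations to the differential system *)

Section ODEOfSolution.
Variable R : realType.
Variables (M C : R) (K J : nat -> nat -> R) (c0 : bool -> nat -> R) (s : bool -> nat -> R -> R).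
Hypotheses (C0 : 0 <= C) (hK : bounded_kernel C (zero_ext2 K)) (hJ : bounded_kernel C (zero_ext2 J)).
Hypothesis hc0 : forall b, nonneg_mass M (zero_ext (c0 b)).
Hypothesis hX : forall b (t : R), 0 <= t -> inXpos 1 (fun i => s b i t).
Hypothesis hcont : forall b i (T : R), (1 <= i)%N -> {within `[0, T], continuous (s b i)}.
Hypothesis hint : forall b i (t : R), (1 <= i)%N -> 0 <= t ->
  lebesgue_measure.-integrable `]0, t[ (rate_sum K (s b) i) /\
  lebesgue_measure.-integrable `]0, t[ (rate_sum J (s b) i).
Hypothesis heq : forall b i (t : R), (1 <= i)%N -> 0 < t ->
  (s b i t)%:E = ((c0 b i)%:E +
    \int[lebesgue_measure]_(z in `]0%R, t[) coag_annih_rhs K J (s b) (s (~~ b)) i z)%E.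

Local Notation x b t := (zero_ext (fun i => s b i t)).
Local Notation r b i t := (rhs (zero_ext2 K) (zero_ext2 J) (x b t) (x (~~ b) t) i).
Local Notation mu := (@lebesgue_measure R).

(** Here the bound may depend on [t]; [x_mass] makes it uniform. *)
Let mass_at b (t : R) : 0 <= t -> exists N, nonneg_mass N (x b t) /\ nonneg_mass N (x (~~ b) t).
Proof.
move=> t0; have [N1 h1] := inXpos_nonneg_mass (hX b t0).
have [N2 h2] := inXpos_nonneg_mass (hX (~~ b) t0).
exists (Num.max N1 N2); split.
  by apply: nonneg_mass_le h1; rewrite le_max lexx.
by apply: nonneg_mass_le h2; rewrite le_max lexx orbT.
Qed.

Let rhs_eq b i t : (1 <= i)%N -> 0 <= t ->
  coag_annih_rhs K J (s b) (s (~~ b)) i t = (r b i t)%:E.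
Proof.
move=> i1 t0; have [N [h1 h2]] := mass_at b t0.
by apply: (coag_annih_rhs_eq C0 hK hJ h1 h2) => // -[].
Qed.

Let rate_eq L b i t : bounded_kernel C (zero_ext2 L) -> (1 <= i)%N -> 0 <= t ->
  rate_sum L (s b) i t = (rate (zero_ext2 L i) (x b t))%:E.
Proof.
move=> hL i1 t0; have [N [h1 h2]] := mass_at b t0.
by apply: (rate_sum_eq C0 hL h1) => // -[].
Qed.

Let rhs_index0 b t : r b 0 t = 0.
Proof. by rewrite /rhs big_ord_recl big_ord0/= !mul0r addr0 mulr0 subrr. Qed.

Let x_cont b i T : {within `[0, T], continuous (fun t => x b t i)}.
Proof.
case: i => [|i] /=; last exact: hcont.
by move=> t; exact: cvg_cst.
Qed.

(** Without a uniform mass bound the rates are not yet known to be continuous. The gain is a finite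
    sum of continuous functions, and the loss a bounded continuous function times rates integrable
    by assumption. *)
Let rhs_integrable b i (t : R) : 0 <= t -> mu.-integrable `]0, t[ (EFin \o (fun z => r b i z)).
Proof.
move=> t0; case: i => [|i].
  apply: (@eq_integrable _ _ _ _ _ _ (cst 0%E)) => //; last exact: integrable0.
  by move=> z _ /=; rewrite rhs_index0.
have sub : [set` `]0, t[] `<=` [set` `[0, t]] by apply: subset_itvW.
pose P z := 2^-1 * (\sum_(j < i.+2) zero_ext2 K j (i.+1 - j)%N * (x b z j * x b z (i.+1 - j)%N)).
have Pc : {within `[0, t], continuous P}.
  move=> z; apply: cvgM; first exact: cvg_cst.
  apply: cvg_big => // [|j _]; first by move=> w; exact: add_continuous.
  by apply: cvgM; [exact: cvg_cst|apply: cvgM; exact: x_cont].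
pose h z := x b z i.+1.
have hc : {within `[0, t], continuous h} by exact: x_cont.
have Pi : mu.-integrable [set` `]0, t[] (EFin \o P).
  apply: (@integrableS _ _ R mu [set` `[0, t]] [set` `]0, t[]) => //.
  by apply: continuous_compact_integrable => //; exact: segment_compact.
have [Ki _] := hint b (ltn0Sn i) t0; have [_ Ji] := hint (~~ b) (ltn0Sn i) t0.
have Qi : mu.-integrable [set` `]0, t[] ((EFin \o h) \* (rate_sum K (s b) i.+1 \+ rate_sum J (s (~~ b)) i.+1))%E.
  apply: integrableMr => //.
  - apply: (measurable_funS _ sub) => //.
    exact: measurable_realfun.subspace_continuous_measurable_fun.
  - have /compact_bounded : compact (h @` [set` `[0, t]]).
      by apply: continuous_compact => //; exact: segment_compact.
    move=> [N [Nr hN]]; exists N; split => // y Ny z /= z0.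
    by apply: (hN _ Ny); exists z => //; exact: sub.
  - exact: integrableD.
have mD : measurable ([set` `]0, t[] : set (measurableTypeR R)) by [].
have PQ := integrableB mD Pi Qi.
apply: (eq_integrable mD _ _ _ PQ).
move=> z; rewrite inE/= in_itv/= => /andP[z0 _].
by rewrite !rate_eq ?(ltW z0).
Qed.

Let rhs_integrableZ k b i (t : R) : 0 <= t ->
  mu.-integrable `]0, t[ (fun z => (k * r b i z)%:E).
Proof.
move=> t0; have mD : measurable ([set` `]0, t[] : set (measurableTypeR R)) by [].
exact: (integrableZl mD k (rhs_integrable b i t0)).
Qed.

Let x_integral b i t : 0 < t ->
  (x b t i)%:E = ((zero_ext (c0 b) i)%:E + \int[mu]_(z in `]0%R, t[) (r b i z)%:E)%E.
Proof.
move=> t0; case: i => [|i] /=.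
  under eq_integral do rewrite rhs_index0.
  by rewrite integral0 adde0.
rewrite heq//; congr (_ + _)%E; apply: eq_integral => z.
by rewrite inE/= in_itv/= => /andP[z0 _]; rewrite rhs_eq// ltW.
Qed.

Let x_Rintegral b i t : 0 < t ->
  x b t i = zero_ext (c0 b) i + \int[mu]_(z in `]0%R, t[) r b i z.
Proof.
move=> t0; have := x_integral b i t0; rewrite /Rintegral => h.
apply: EFin_inj; rewrite h EFinD fineK//.
by apply: integrable_fin_num => //; exact: rhs_integrable (ltW t0).
Qed.

(** Integrate the finite sum of [i * r b i z]. By [rhs_mass_le0] it is nonpositive at each time,
    whatever the bound valid at that time, so partial masses never exceed the initial bound [M]. *)
Let x_mass b t : 0 < t -> nonneg_mass M (x b t).
Proof.
move=> t0; have [N [h1 _]] := mass_at b (ltW t0).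
split=> [i|n]; first exact: nonneg_mass_ge0 h1 i.
rewrite -lee_fin -sumEFin.
have term (i : 'I_n) : (i%:R * x b t i)%:E = ((i%:R * zero_ext (c0 b) i)%:E +
    \int[mu]_(z in `]0%R, t[) (i%:R * r b i z)%:E)%E.
  under eq_integral do rewrite EFinM.
  rewrite integralZl//; last exact: rhs_integrable (ltW t0).
  rewrite -[X in (_ + _ * X)%E]fineK; last first.
    by apply: integrable_fin_num => //; exact: rhs_integrable (ltW t0).
  by rewrite -EFinM -EFinD -mulrDr -x_Rintegral.
under eq_bigr do rewrite term.
rewrite big_split/= sumEFin -integral_sum//; last first.
  by move=> i; exact: rhs_integrableZ (ltW t0).
apply: (@le_trans _ _ (M%:E + 0)%E); last by rewrite adde0.
apply: leeD; first by rewrite lee_fin; exact: (hc0 b).2.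
rewrite -[leRHS](integral0 mu [set` `]0, t[]); apply: le_integral => //.
- by apply: integrable_sum => // i _; exact: rhs_integrableZ (ltW t0).
- exact: integrable0.
- move=> z; rewrite inE/= in_itv/= => /andP[z0 _]; rewrite sumEFin lee_fin.
  have [N' [h1' h2']] := mass_at b (ltW z0).
  exact: (rhs_mass_le0 C0 hK hJ h1' h2').
Qed.

Let x_lipschitz0 b i t : 0 < t -> `|x b t i - zero_ext (c0 b) i| <= lipc M C i * t.
Proof.
move=> t0; rewrite x_Rintegral// addrAC subrr add0r.
have hi := rhs_integrable b i (ltW t0).
rewrite (le_trans (le_normr_Rintegral _ hi))//.
apply: (@le_trans _ _ (\int[mu]_(z in `]0%R, t[) lipc M C i)).
  apply: le_Rintegral => //.
  - exact: (@integrable_norm _ _ _ _ _ _ hi).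
  - by apply: continuous_integrable => z; exact: cvg_cst.
  - move=> z /=; rewrite in_itv/= => /andP[z0 _].
    exact: (rhs_bound C0 hK hJ (x_mass b z0) (x_mass (~~ b) z0)).
by rewrite Rintegral_cst//= lebesgue_measure_itv/= lte_fin t0 -EFinB subr0.
Qed.

(** The integral equation is given for [t > 0] only; the value at 0 follows by right continuity and
    [x_lipschitz0]. *)
Lemma solution_initial b i : (1 <= i)%N -> s b i 0 = c0 b i.
Proof.
move=> i1.
have h1 : s b i t @[t --> 0^'+] --> s b i 0.
  by have /(continuous_within_itvP _ ltr01)[_ + _] := @hcont b i 1 i1.
have h2 : s b i t @[t --> 0^'+] --> c0 b i.
  have -> : s b i = (fun t => x b t i) by case: i i1 {h1}.
  have -> : c0 b i = zero_ext (c0 b) i by case: i i1 {h1}.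
  apply/cvgrPdist_le => e e0.
  have M0 := nonneg_mass_M_ge0 (hc0 true).
  have L1 : 0 < lipc M C i + 1 by rewrite ltr_wpDl// /lipc !mulr_ge0 ?exprn_ge0.
  near=> t.
  have t0 : 0 < t by near: t; exact: nbhs_right_gt.
  rewrite distrC (le_trans (x_lipschitz0 b i t0))//.
  apply: (@le_trans _ _ ((lipc M C i + 1) * t)); first by rewrite ler_wpM2r ?(ltW t0)// lerDl.
  rewrite mulrC -ler_pdivlMr//; near: t; apply: nbhs_right_le.
  by rewrite divr_gt0.
exact: (cvg_unique _ h1 h2).
Unshelve. all: by end_near. Qed.

Definition extended_solution b i t : R := if t <= 0 then zero_ext (c0 b) i else x b t i.
Local Notation c := extended_solution.

Let c_mass b (t : R) : nonneg_mass M (fun i => c b i t).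
Proof.
rewrite /extended_solution; case: (leP t 0) => t0; [exact: hc0|exact: x_mass].
Qed.

Let c_cont b i : continuous (c b i).
Proof.
have M0 := nonneg_mass_M_ge0 (hc0 true).
have L1 : 0 < lipc M C i + 1 by rewrite ltr_wpDl// /lipc !mulr_ge0 ?exprn_ge0.
move=> t; case: (ltgtP t 0) => t0.
- have hn : {near t, (fun=> zero_ext (c0 b) i) =1 c b i}.
    near=> z; rewrite /extended_solution ifT//.
    by apply: ltW; near: z; exact: lt_nbhsl.
  apply: cvg_trans (near_eq_cvg hn) _.
  by rewrite /extended_solution (ltW t0); exact: cvg_cst.
- have hn : {near t, (fun z => x b z i) =1 c b i}.
    near=> z; rewrite /extended_solution ifF//.
    by apply/negbTE; rewrite -ltNge; near: z; exact: lt_nbhsr.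
  apply: cvg_trans (near_eq_cvg hn) _.
  rewrite /extended_solution leNgt t0/=.
  apply: (within_continuous_continuous _ (@x_cont b i (t + 1))).
    by rewrite (lt_trans t0)// ltrDl.
  by rewrite in_itv/= t0 ltrDl ltr01.
(* At 0 the two branches are joined by the Lipschitz bound from the initial value. *)
- apply/cvgrPdist_le => e e0; near=> z.
  rewrite {1}/extended_solution t0 lexx distrC.
  have zle : `|z| <= e / (lipc M C i + 1).
    near: z; rewrite t0.
    have := @cvgr_dist_le _ _ _ (nbhs (0 : R)) _ id 0 cvg_id (e / (lipc M C i + 1)).
    rewrite divr_gt0// => /(_ _ isT); apply: filterS => z /=.
    by rewrite sub0r normrN.
  apply: (@le_trans _ _ ((lipc M C i + 1) * `|z|)).
    rewrite /extended_solution; case: (leP z 0) => z0.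
      by rewrite subrr normr0 mulr_ge0 ?(ltW L1).
    rewrite (le_trans (x_lipschitz0 b i z0))// (gtr0_norm z0) ler_wpM2r ?(ltW z0)//.
    by rewrite lerDl.
  by rewrite mulrC -ler_pdivlMr.
Unshelve. all: by end_near. Qed.

(** With the uniform mass bound, the right-hand side along [c] is continuous, so the integral
    equation can be differentiated at each positive time. *)
Lemma extended_solution_ode :
  coag_annih_ode M (zero_ext2 K) (zero_ext2 J) (fun b => zero_ext (c0 b)) c.
Proof.
split=> [//|b i t t0|//|b i t t0]; first by rewrite /extended_solution t0.
pose r' z := rhs (zero_ext2 K) (zero_ext2 J) (fun j => c b j z) (fun j => c (~~ b) j z) i.
have r'c : continuous r' by exact: (rhs_continuous C0 hK hJ c_mass c_cont).
pose F z := \int[mu]_(w in [set` Interval (BLeft 0) (BRight z)]) r' w.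
have tt1 : t < t + 1 by rewrite ltrDl.
have r'i : mu.-integrable [set` Interval (BLeft 0) (BRight (t + 1))] (EFin \o r').
  apply: continuous_compact_integrable; first exact: segment_compact.
  exact: continuous_subspaceT.
have [|dF F't] := continuous_FTC1 tt1 r'i _ (r'c t).
  by rewrite lte_fin.
have FD : is_derive t 1 F (r' t) by apply: DeriveDef => //; rewrite -derive1E.
have hn : \near t, (cst (zero_ext (c0 b) i) + F) t = c b i t.
  near=> z.
  have z0 : 0 < z by near: z; exact: lt_nbhsr.
  rewrite /extended_solution leNgt z0/= x_Rintegral//.
  congr (_ + _); rewrite /F /Rintegral; congr (fine _).
  rewrite integral_itv_bndoo; last first.
    by apply: (measurable_int mu); exact: continuous_integrable.
  apply: eq_integral => w; rewrite inE/= in_itv/= => /andP[w0 _].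
  rewrite /r'; congr (rhs _ _ _ _ _)%:E; apply/funext => j.
    by rewrite /extended_solution leNgt w0.
  by rewrite /extended_solution leNgt w0.
apply: (near_eq_is_derive hn).
by rewrite -[X in is_derive _ _ _ X]add0r; exact: is_deriveD.
Unshelve. all: by end_near. Qed.

Lemma extended_solutionE b i t : (1 <= i)%N -> 0 <= t -> c b i t = s b i t.
Proof.
move=> i1; rewrite le_eqVlt /extended_solution => /orP[/eqP <-|t0].
  by rewrite lexx solution_initial//; case: i i1.
by rewrite leNgt t0; case: i i1.
Qed.

End ODEOfSolution.

(** * The theorem *)

Lemma powR_rate_le (R : realType) (alpha : R) (i j : nat) : alpha <= 2^-1 ->
  (1 <= i)%N -> (1 <= j)%N -> (i * j)%:R `^ alpha <= rootn R i * rootn R j.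
Proof.
move=> ha i1 j1; rewrite -sqrtrM// -natrM -powR12_sqrt//.
by apply: ler_powR => //; rewrite ler1n muln_gt0 i1.
Qed.

Theorem theorem2p5 (R : realType) (alpha : R) (K J : nat -> nat -> R)
    (kappa2 kappa3 : R) (a0 b0 : nat -> R)
    (halpha : 0 <= alpha <= 2^-1)
    (hkappa2 : 0 < kappa2) (hkappa3 : 0 < kappa3)
    (hK : forall i j : nat, (1 <= i)%N -> (1 <= j)%N -> 0 <= K i j /\ K i j = K j i)
    (hJ : forall i j : nat, (1 <= i)%N -> (1 <= j)%N -> 0 <= J i j /\ J i j = J j i)
    (hKle : forall i j : nat, (1 <= i)%N -> (1 <= j)%N ->
      K i j <= kappa2 * (i * j)%:R `^ alpha)
    (hJle : forall i j : nat, (1 <= i)%N -> (1 <= j)%N ->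
      J i j <= kappa3 * (i * j)%:R `^ alpha)
    (ha0 : inXpos 1 a0) (hb0 : inXpos 1 b0) :
  exists a b : nat -> R -> R,
    [/\ is_solution K J +oo%E a0 b0 a b,
        forall t : R, 0 <= t ->
          inXpos 1 (fun i => a i t) /\ inXpos 1 (fun i => b i t) &
        forall a' b' : nat -> R -> R,
          is_solution K J +oo%E a0 b0 a' b' ->
          (forall t : R, 0 <= t ->
            inXpos 1 (fun i => a' i t) /\ inXpos 1 (fun i => b' i t)) ->
          forall (i : nat) (t : R), (1 <= i)%N -> 0 <= t ->
            a' i t = a i t /\ b' i t = b i t].
Proof.
have /andP[_ ha] := halpha.
(* One constant for both kernels. *)
pose C := kappa2 + kappa3.
have C0 : 0 <= C by rewrite addr_ge0 ?ltW.
have bK : bounded_kernel C (zero_ext2 K).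
  apply: bounded_zero_ext2 => // i j i1 j1; have [K0 Ks] := hK i j i1 j1; split => //.
  apply: (le_trans (hKle i j i1 j1)); apply: ler_pM; rewrite ?powR_ge0 ?powR_rate_le//.
    exact: ltW.
  by rewrite /C lerDl ltW.
have bJ : bounded_kernel C (zero_ext2 J).
  apply: bounded_zero_ext2 => // i j i1 j1; have [J0 Js] := hJ i j i1 j1; split => //.
  apply: (le_trans (hJle i j i1 j1)); apply: ler_pM; rewrite ?powR_ge0 ?powR_rate_le//.
    exact: ltW.
  by rewrite /C lerDr ltW.
have [M hM] : exists M, forall b : bool, nonneg_mass M (zero_ext (if b then a0 else b0)).
  have [M1 h1] := inXpos_nonneg_mass ha0; have [M2 h2] := inXpos_nonneg_mass hb0.
  exists (Num.max M1 M2) => -[].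
    by apply: nonneg_mass_le h1; rewrite le_max lexx.
  by apply: nonneg_mass_le h2; rewrite le_max lexx orbT.
have [c hc] := coag_annih_ode_exists C0 bK bJ hM.
exists (c true), (c false); split.
- exact: (ode_is_solution C0 bK bJ hc).
- have [hm _ _ _] := hc.
  by move=> t _; split; [exact: nonneg_mass_inXpos (hm true t)|exact: nonneg_mass_inXpos (hm false t)].
move=> a' b' [_ scont sint seq] sX i t i1 t0.
pose s (b : bool) := if b then a' else b'.
pose c0 (b : bool) := if b then a0 else b0.
have hX b (z : R) : 0 <= z -> inXpos 1 (fun k => s b k z).
  by move=> /sX[? ?]; case: b.
have hcont b k (T : R) : (1 <= k)%N -> {within `[0, T], continuous (s b k)}.
  move=> /scont[ca cb].
  have sub : [set` `[0, T]] `<=` [set z : R | 0 <= z /\ (z%:E < +oo)%E].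
    by move=> z /=; rewrite in_itv/= => /andP[z0 _]; split => //; exact: ltry.
  by case: b; apply: continuous_subspaceW sub _.
have hint b k (z : R) : (1 <= k)%N -> 0 <= z ->
    lebesgue_measure.-integrable `]0, z[ (rate_sum K (s b) k) /\
    lebesgue_measure.-integrable `]0, z[ (rate_sum J (s b) k).
  by move=> k1 z0; have [? ? ? ?] := sint k z k1 z0 (ltry z); case: b.
have heq b k (z : R) : (1 <= k)%N -> 0 < z -> (s b k z)%:E = ((c0 b k)%:E +
    \int[lebesgue_measure]_(w in `]0%R, z[) coag_annih_rhs K J (s b) (s (~~ b)) k w)%E.
  by move=> k1 z0; have [? ?] := seq k z k1 z0 (ltry z); case: b.
(* The competing solution satisfies the differential system with the same [M] and initial data, so
   uniqueness there applies. *)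
have hs := extended_solution_ode C0 bK bJ hM hX hcont hint heq.
have eqs b : s b i t = c b i t.
  rewrite -(extended_solutionE C0 bK bJ hM hX hcont hint heq b i1 t0).
  exact: (coag_annih_ode_unique C0 bK bJ hs hc b i1 t0).
by split; [exact: (eqs true)|exact: (eqs false)].
Qed.
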